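(* Let $\mathcal{A}_{t,h}$ be a two-parameter $U_h(\mathfrak{g})$-invariant quantization of a commutative ($U(\mathfrak{g})$-invariant) algebra $\mathcal{A}$ such that $\mathcal{A}_{t,0}$ is a one-parameter $U(\mathfrak{g})$-invariant quantization of $\mathcal{A}$ with Poisson bracket $s$. Then the $U_h(\mathfrak{g})$-invariant quantization $\mathcal{A}_{0,h}$ has a Poisson bracket $p$ of the form $p=f-\{\cdot,\cdot\}_r$, where $f$ is a $U(\mathfrak{g})$-invariant bracket on $\mathcal{A}$ such that $[\![f,f]\!]=-\varphi_{\mathcal{A}}$ and $f$ is compatible with $s$, i.e. $[\![f,s]\!]=0$.
   Context: $\mathfrak{g}$ is a finite-dimensional complex semisimple Lie algebra and $r\in\wedge^2\mathfrak{g}$ is a classical $r$-matrix, i.e. $\varphi:=[\![r,r]\!]\in\wedge^3\mathfrak{g}$ (Schouten bracket) is $\mathfrak{g}$-invariant. $U_h(\mathfrak{g})$ is a quantum group quantizing the Lie bialgebra $(\mathfrak{g},r)$ with cobracket $\delta(x)=[r,\Delta(x)]$: a topological Hopf algebra over $\mathbb{C}[[h]]$, isomorphic to (and identified with) $U(\mathfrak{g})[[h]]$ as a topological algebra, reducing modulo $h$ to the Hopf algebra $U(\mathfrak{g})$, with comultiplication $\Delta_h(x)=F_h\Delta(x)F_h^{-1}$, $F_h=1\otimes 1+\frac h2r+o(h)$; here $\Delta$ is the usual comultiplication of $U(\mathfrak{g})$. A $U(\mathfrak{g})$-invariant algebra is an algebra $\mathcal{A}$ with a $U(\mathfrak{g})$-module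 structure whose multiplication $\mu$ satisfies $x\mu(a\otimes b)=\mu\Delta(x)(a\otimes b)$. A one-parameter quantization of $\mathcal{A}$ with parameter $h$ (or $t$) is an associative algebra isomorphic to $\mathcal{A}[[h]]$ as a $\mathbb{C}[[h]]$-module, with multiplication $\mu_h=\mu+h\mu_1+o(h)$; its Poisson bracket is $\mu_1(a,b)-\mu_1(b,a)$. A two-parameter quantization is an associative algebra $\mathcal{A}_{t,h}$ isomorphic to $\mathcal{A}[[t,h]]$ as a $\mathbb{C}[[t,h]]$-module with multiplication $\mu_{t,h}=\mu+t\mu_1'+h\mu_1''+o(t,h)$; its bracket along $t$ is $s(a,b)=\mu'_1(a,b)-\mu'_1(b,a)$ and its bracket along $h$ is $p(a,b)=\mu''_1(a,b)-\mu''_1(b,a)$. Such a quantization with multiplication $m$ is $U_h(\mathfrak{g})$-invariant (resp. $U(\mathfrak{g})$-invariant) if $x\,m(a\otimes b)=m\Delta_h(x)(a\otimes b)$ (resp. $x\,m(a\otimes b)=m\Delta(x)(a\otimes b)$) for $x\in U(\mathfrak{g})$. A bracket on $\mathcal{A}$ is a skew-symmetric bilinear map $\mathcal{A}\otimes\mathcal{A}\to\mathcal{A}$ satisfying the Leibniz rule in each argument; it is $U(\mathfrak{g})$-invariant if it commutes with the $U(\mathfrak{g})$-action. The $r$-matrix bracket is $\{a,b\}_r=(r_1a)(r_2b)$, $r=r_1\otimes r_2$ (summation implicit). The Schouten bracket of brackets is $[\![f,g]\!](a,b,c)=f(g(a,b),c)+g(f(a,b),c)+$ cyclic permutations of $a,b,c$;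 $f,g$ are compatible if $[\![f,g]\!]=0$. Finally $\varphi_{\mathcal{A}}(a,b,c)=(\varphi_1a)(\varphi_2b)(\varphi_3c)$ for $\varphi=\varphi_1\otimes\varphi_2\otimes\varphi_3$ (summation implicit), the Schouten bracket on $\wedge^\bullet\mathfrak{g}$ being normalized so that the Schouten bracket of $\{\cdot,\cdot\}_r$ with itself is $\varphi_{\mathcal{A}}$. *)

(* Defs.v *)
From HB Require Import structures.
From mathcomp Require Import all_boot all_order all_algebra.
From mathcomp Require Import finmap boolp functions reals.
From mathcomp.real_closed Require Import complex.
From mathcomp.multinomials Require Import monalg.

Set Implicit Arguments.
Unset Strict Implicit.
Unset Printing Implicit Defensive.

Import GRing.Theory.
Local Open Scope ring_scope.
Local Open Scope quotient_scope.

Definition bilinear_map (K : fieldType) (V W Z : lmodType K)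
    (b : V -> W -> Z) : Prop :=
  (forall v, linear (b v)) /\ (forall w, linear (b^~ w)).

Lemma linear_map0 (K : fieldType) (V W : lmodType K) (f : V -> W) :
  linear f -> f 0 = 0.
Proof. by move=> lf; have := lf (-1) 0 0; rewrite !scaleN1r !addNr. Qed.

Section LinearQuotient.
Variables (K : fieldType) (M : lmodType K) (S : M -> Prop).

Inductive lspan : M -> Prop :=
| lspan0 : lspan 0
| lspan_step (a : K) (x y : M) : S x -> lspan y -> lspan (a *: x + y).

Lemma lspanD x y : lspan x -> lspan y -> lspan (x + y).
Proof.
elim=> [|a u v Su _ IH] ly; first by rewrite add0r.
by rewrite -addrA; apply: lspan_step Su (IH ly).
Qed.

Lemma lspanZ a x : lspan x -> lspan (a *: x).
Proof.
elim=> [|b u v Su _ IH]; first by rewrite scaler0; apply: lspan0.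
by rewrite scalerDr scalerA; apply: lspan_step.
Qed.

Lemma lspanN x : lspan x -> lspan (- x).
Proof. by rewrite -scaleN1r; apply: lspanZ. Qed.

Lemma lspan_in x : S x -> lspan x.
Proof. by move=> Sx; have := lspan_step 1 Sx lspan0; rewrite scale1r addr0. Qed.

Definition lquot_rel (x y : M) : bool := `[< lspan (x - y) >].

Lemma lquot_rel_refl : reflexive lquot_rel.
Proof. by move=> x; apply/asboolP; rewrite subrr; apply: lspan0. Qed.
Lemma lquot_rel_sym : symmetric lquot_rel.
Proof.
by move=> x y; apply/asboolP/asboolP => /lspanN; rewrite opprB.
Qed.
Lemma lquot_rel_trans : transitive lquot_rel.
Proof.
move=> y x z /asboolP xy /asboolP yz; apply/asboolP.
by have := lspanD xy yz; rewrite addrA subrK.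
Qed.

Canonical lquot_equiv :=
  EquivRel lquot_rel lquot_rel_refl lquot_rel_sym lquot_rel_trans.

Definition lquot := {eq_quot lquot_equiv}.
HB.instance Definition _ := Choice.on lquot.
HB.instance Definition _ := EqQuotient.on lquot.

End LinearQuotient.

HB.lock Definition lproj (K : fieldType) (M : lmodType K) (S : M -> Prop)
  (x : M) : lquot S := \pi_(lquot S) x.

Section LinearQuotientTheory.
Variables (K : fieldType) (M : lmodType K) (S : M -> Prop).
Local Notation lspan := (lspan S).
Local Notation lquot := (lquot S).
Local Notation lproj := (lproj S).

Lemma lreprK (q : lquot) : lproj (repr q) = q.
Proof. by rewrite unlock reprK. Qed.

Lemma lprojP x y : lproj x = lproj y <-> lspan (x - y).
Proof.
rewrite unlock; split=> [/eqmodP/asboolP //|lxy].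
by apply/eqmodP/asboolP.
Qed.

Lemma lreprP x : lspan (repr (lproj x) - x).
Proof. by apply/lprojP; rewrite lreprK. Qed.

Lemma lproj_ind (P : lquot -> Prop) : (forall x, P (lproj x)) -> forall q, P q.
Proof. by move=> Px q; rewrite -[q]lreprK; apply: Px. Qed.

(* The operations are kept opaque, so that unification never unfolds them. *)
Fact lquot_add_sig : {add : lquot -> lquot -> lquot |
  forall x y, add (lproj x) (lproj y) = lproj (x + y)}.
Proof.
exists (fun x y => lproj (repr x + repr y)) => x y.
by apply/lprojP; rewrite opprD addrACA; apply: lspanD; apply: lreprP.
Qed.
Fact lquot_opp_sig : {opp : lquot -> lquot |
  forall x, opp (lproj x) = lproj (- x)}.
Proof.
exists (fun x => lproj (- repr x)) => x.
by apply/lprojP; rewrite -opprD; apply/lspanN/lreprP.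
Qed.
Fact lquot_scale_sig : {scale : K -> lquot -> lquot |
  forall a x, scale a (lproj x) = lproj (a *: x)}.
Proof.
exists (fun a x => lproj (a *: repr x)) => a x.
by apply/lprojP; rewrite -scalerBr; apply/lspanZ/lreprP.
Qed.

Let zero : lquot := lproj 0.
Let add := sval lquot_add_sig.
Let opp := sval lquot_opp_sig.
Let scale := sval lquot_scale_sig.
Let addE : forall x y, add (lproj x) (lproj y) = lproj (x + y) := svalP lquot_add_sig.
Let oppE : forall x, opp (lproj x) = lproj (- x) := svalP lquot_opp_sig.
Let scaleE : forall a x, scale a (lproj x) = lproj (a *: x) := svalP lquot_scale_sig.

Let addA : associative add.
Proof.
by elim/lproj_ind=> x; elim/lproj_ind=> y; elim/lproj_ind=> z; rewrite !addE addrA.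
Qed.
Let addC : commutative add.
Proof. by elim/lproj_ind=> x; elim/lproj_ind=> y; rewrite !addE addrC. Qed.
Let add0 : left_id zero add.
Proof. by elim/lproj_ind=> x; rewrite addE add0r. Qed.
Let addN : left_inverse zero opp add.
Proof. by elim/lproj_ind=> x; rewrite oppE addE addNr. Qed.

HB.instance Definition _ := GRing.isZmodule.Build lquot addA addC add0 addN.

Lemma lprojD x y : lproj (x + y) = lproj x + lproj y.
Proof. by rewrite -addE. Qed.

Let scaleA a b x : scale a (scale b x) = scale (a * b) x.
Proof. by elim/lproj_ind: x => x; rewrite !scaleE scalerA. Qed.
Let scale1 : left_id 1 scale.
Proof. by elim/lproj_ind=> x; rewrite !scaleE scale1r. Qed.
Let scaleDr : right_distributive scale +%R.
Proof.
move=> a; elim/lproj_ind=> x; elim/lproj_ind=> y.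
by rewrite -lprojD !scaleE scalerDr lprojD.
Qed.
Let scaleDl x : {morph scale^~ x : a b / a + b}.
Proof.
by move=> a b; elim/lproj_ind: x => x; rewrite !scaleE scalerDl lprojD.
Qed.

HB.instance Definition _ :=
  GRing.Zmodule_isLmodule.Build K lquot scaleA scale1 scaleDr scaleDl.

Lemma lproj_is_linear : linear lproj.
Proof. by move=> a x y; rewrite lprojD -scaleE. Qed.
HB.instance Definition _ :=
  GRing.isLinear.Build K M lquot *:%R lproj lproj_is_linear.

Lemma lproj_eq0 x : lspan x -> lproj x = 0.
Proof. by move=> lx; apply/lprojP; rewrite subr0. Qed.

End LinearQuotientTheory.

Section FreeLift.
Variables (K : fieldType) (X : choiceType) (Z : lmodType K).

Definition freelift (f : X -> Z) (p : {malg K[X]}) : Z :=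
  \sum_(k <- msupp p) p@_k *: f k.

Lemma freelift_is_linear f : linear (freelift f).
Proof.
have E (d : {fset X}%fset) (p : {malg K[X]}) : (msupp p `<=` d)%fset ->
    freelift f p = \sum_(k <- d) p@_k *: f k.
  move=> le; rewrite /freelift (big_fset_incl _ le) //= => k _ kp.
  by rewrite mcoeff_outdom // scale0r.
move=> a p q.
pose d := (msupp p `|` msupp q)%fset.
rewrite (E d); last first.
  apply: (fsubset_trans (msuppD_le _ _)).
  by apply: fsetSU; apply: msuppZ_le.
rewrite (E d p) ?fsubsetUl // (E d q) ?fsubsetUr //.
rewrite scaler_sumr -big_split /=; apply: eq_bigr => k _.
by rewrite mcoeffD mcoeffZ scalerDl scalerA.
Qed.
HB.instance Definition _ f :=
  GRing.isLinear.Build K {malg K[X]} Z *:%R (freelift f) (freelift_is_linear f).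

Lemma freelift_comb c (f f1 f2 : X -> Z) p :
  (forall k, f k = c *: f1 k + f2 k) ->
  freelift f p = c *: freelift f1 p + freelift f2 p.
Proof.
move=> E; rewrite /freelift scaler_sumr -big_split /=; apply: eq_bigr => k _.
by rewrite E scalerDr !scalerA (mulrC c).
Qed.

Lemma freeliftU f k : freelift f << k >> = f k.
Proof. by rewrite /freelift msuppU oner_eq0 big_seq_fset1 mcoeffUU scale1r. Qed.

Lemma free_linear_eq (f g : {malg K[X]} -> Z) : linear f -> linear g ->
  (forall k, f << k >> = g << k >>) -> f =1 g.
Proof.
move=> lf lg fg p; rewrite [p]monalgE.
have E k : << p@_k *g k >> = p@_k *: << k >> :> {malg K[X]}.
  by apply/malgP => x; rewrite mcoeffZ !mcoeffU mulrnAr mulr1.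
elim: (enum_fset _) => [|k l IH]; first by rewrite big_nil !linear_map0.
by rewrite big_cons E lf lg IH fg.
Qed.

End FreeLift.

Section Tensor.
Variables (K : fieldType) (V W : lmodType K).

Inductive tensor_relator : {malg K[(V * W)%type]} -> Prop :=
| tensor_relator_l a v v' w : tensor_relator
    (<< (a *: v + v', w) >> - (a *: << (v, w) >> + << (v', w) >>))
| tensor_relator_r a v w w' : tensor_relator
    (<< (v, a *: w + w') >> - (a *: << (v, w) >> + << (v, w') >>)).

Definition tensor := lquot tensor_relator.
HB.instance Definition _ := GRing.Lmodule.on tensor.

End Tensor.

HB.lock Definition tens (K : fieldType) (V W : lmodType K) (v : V) (w : W) :
  tensor V W := lproj (@tensor_relator K V W) << (v, w) >>.

Section TensorTheory.
Variables (K : fieldType) (V W : lmodType K).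
Local Notation tensor := (tensor V W).
Local Notation tens := (@tens K V W).
Local Notation tensor_relator := (@tensor_relator K V W).

Lemma tensE v w : tens v w = lproj tensor_relator << (v, w) >>.
Proof. by rewrite unlock. Qed.

Lemma tens_bilinear : bilinear_map tens.
Proof.
split=> [v a w w'|w a v v']; rewrite !tensE.
  apply: etrans (lproj_is_linear _ _ _ _).
  by apply/lprojP/lspan_in/tensor_relator_r.
apply: etrans (lproj_is_linear _ _ _ _).
by apply/lprojP/lspan_in/tensor_relator_l.
Qed.

Section Lift.
Variable Z : lmodType K.

(* The linear map induced by a bilinear [b]: on a representative
   [\sum_i a_i v_i (x) w_i] it is [\sum_i a_i b(v_i, w_i)]. *)
Definition tlift (b : V -> W -> Z) (t : tensor) : Z :=
  freelift (fun p => b p.1 p.2) (repr t).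

Lemma tlift_proj b : bilinear_map b ->
  forall p, tlift b (lproj tensor_relator p) = freelift (fun p => b p.1 p.2) p.
Proof.
move=> [br bl] p; apply/eqP; rewrite -subr_eq0 /tlift -linearB /=; apply/eqP.
elim: (lreprP tensor_relator p) => [|a x y Sx _ IH]; first exact: linear0.
rewrite freelift_is_linear IH addr0.
by case: Sx => *; rewrite linearB /= freelift_is_linear !freeliftU /= ?br ?bl subrr scaler0.
Qed.

Lemma tliftE b v w : bilinear_map b -> tlift b (tens v w) = b v w.
Proof. by move=> bb; rewrite tensE tlift_proj // freeliftU. Qed.

Lemma tlift_linear b : bilinear_map b -> linear (tlift b).
Proof.
move=> bb a; elim/lproj_ind=> x; elim/lproj_ind=> y.
by rewrite -lproj_is_linear !tlift_proj // freelift_is_linear.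
Qed.

Lemma tlift_comb c (b b1 b2 : V -> W -> Z) t :
  (forall v w, b v w = c *: b1 v w + b2 v w) ->
  tlift b t = c *: tlift b1 t + tlift b2 t.
Proof. by move=> E; apply: freelift_comb => -[v w]; apply: E. Qed.

Lemma tensor_linear_eq (f f' : tensor -> Z) : linear f -> linear f' ->
  (forall v w, f (tens v w) = f' (tens v w)) -> f =1 f'.
Proof.
move=> lf lf' E; elim/lproj_ind.
apply: free_linear_eq => [a x y|a x y|[v w]]; last by rewrite -tensE; apply: E.
  by rewrite lproj_is_linear lf.
by rewrite lproj_is_linear lf'.
Qed.

End Lift.
End TensorTheory.

Arguments tens {K V W}.
Notation "V '⊗T' W" := (tensor V W) (at level 40, left associativity) : type_scope.
Notation "v ⊗ w" := (tens v w) (at level 40, left associativity) : ring_scope.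

Section TensorInduction.
Variables (K : fieldType) (V W : lmodType K).

Lemma tensor_ind (P : tensor V W -> Prop) : P 0 ->
  (forall a v w t, P t -> P (a *: (v ⊗ w) + t)) -> forall t, P t.
Proof.
move=> P0 PS; elim/lproj_ind => p; rewrite [p]monalgE.
elim: (enum_fset _) => [|[v w] l IH]; first by rewrite big_nil linear0.
rewrite big_cons.
have -> : << p@_(v, w) *g (v, w) >> = p@_(v, w) *: << (v, w) >>
    :> {malg K[(V * W)%type]}.
  by apply/malgP => x; rewrite mcoeffZ !mcoeffU mulrnAr mulr1.
by rewrite lproj_is_linear -tensE; apply: PS.
Qed.

End TensorInduction.

Section TensorAlgebra.
Variables (K : fieldType) (A B : algType K).
Implicit Types t u : tensor A B.

Definition tone : tensor A B := 1 ⊗ 1.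

Let tmul_in a b : bilinear_map (fun a' b' => (a * a') ⊗ (b * b') : tensor A B).
Proof.
have [tr tl] := @tens_bilinear K A B.
by split=> [x c y z|x c y z]; rewrite mulrDr -scalerAr ?tr ?tl.
Qed.

Let tmul_out u : bilinear_map
  (fun a b => tlift (fun a' b' => (a * a') ⊗ (b * b') : tensor A B) u).
Proof.
have [tr tl] := @tens_bilinear K A B.
split=> [x c y z|x c y z]; apply: tlift_comb => a' b'.
  by rewrite mulrDl -scalerAl tr.
by rewrite mulrDl -scalerAl tl.
Qed.

Fact tmul_sig : {tmul : tensor A B -> tensor A B -> tensor A B |
  forall t u, tmul t u =
    tlift (fun a b => tlift (fun a' b' => (a * a') ⊗ (b * b')) u) t}.
Proof. by eexists. Qed.
Let tmul := sval tmul_sig.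

Let tmul_linl u : linear (tmul^~ u).
Proof. by move=> a x y; rewrite /tmul !(svalP tmul_sig) (tlift_linear (tmul_out u)). Qed.

Let tmul_pure a b u :
  tmul (a ⊗ b) u = tlift (fun a' b' => (a * a') ⊗ (b * b')) u.
Proof. by rewrite /tmul (svalP tmul_sig) (tliftE _ _ (tmul_out u)). Qed.

Let tmulE a b a' b' : tmul (a ⊗ b) (a' ⊗ b') = (a * a') ⊗ (b * b').
Proof. by rewrite tmul_pure; apply: tliftE (tmul_in a b). Qed.

Let tmul_bilinear : bilinear_map tmul.
Proof.
split=> [t c u v|u]; last exact: tmul_linl.
elim/tensor_ind: t => [|d a b t IH].
  by rewrite !(linear_map0 (tmul_linl _)) scaler0 addr0.
rewrite !tmul_linl IH !tmul_pure (tlift_linear (tmul_in a b)).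
move: (tlift _ u) (tlift _ v) (tmul t u) (tmul t v) => p q p' q'.
by rewrite !scalerDr !scalerA addrACA (mulrC c).
Qed.

Let tmulA : associative tmul.
Proof.
have [mr ml] := tmul_bilinear.
move=> t u v; elim/tensor_ind: t => [|c a b t IH].
  by rewrite !(linear_map0 (ml _)).
rewrite !ml IH; congr (_ *: _ + _); elim/tensor_ind: u {IH} => [|d a' b' u IH'].
  by rewrite !(linear_map0 (ml _)) !(linear_map0 (mr _)) !(linear_map0 (ml _)).
rewrite !ml !mr !ml IH'; congr (_ *: _ + _).
elim/tensor_ind: v {IH'} => [|e a2 b2 v IH2]; first by rewrite !(linear_map0 (mr _)).
by rewrite !mr IH2 !tmulE !mulrA.
Qed.

Let tmul1 : left_id tone tmul.
Proof.
have [mr ml] := tmul_bilinear.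
elim/tensor_ind => [|c a b t IH]; first by rewrite !(linear_map0 (mr _)).
by rewrite mr IH tmulE !mul1r.
Qed.

Let tmulr1 : right_id tone tmul.
Proof.
have [mr ml] := tmul_bilinear.
elim/tensor_ind => [|c a b t IH]; first by rewrite !(linear_map0 (ml _)).
by rewrite ml IH tmulE !mulr1.
Qed.

Let tmulDl : left_distributive tmul +%R.
Proof. by move=> t u v; have := tmul_bilinear.2 v 1 t u; rewrite !scale1r. Qed.
Let tmulDr : right_distributive tmul +%R.
Proof. by move=> t u v; have := tmul_bilinear.1 t 1 u v; rewrite !scale1r. Qed.

HB.instance Definition _ := GRing.Zmodule_isPzRing.Build (tensor A B)
  tmulA tmul1 tmulr1 tmulDl tmulDr.

Lemma tensM a b a' b' :
  (a ⊗ b) * (a' ⊗ b') = (a * a') ⊗ (b * b') :> tensor A B.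
Proof. exact: tmulE. Qed.

Lemma tens_scalerAl (c : K) t u : c *: (t * u) = (c *: t) * u.
Proof. by have := tmul_bilinear.2 u c t 0; rewrite (linear_map0 (tmul_bilinear.2 _)) !addr0. Qed.

Lemma tens_scalerAr (c : K) t u : c *: (t * u) = t * (c *: u).
Proof. by have := tmul_bilinear.1 t c u 0; rewrite (linear_map0 (tmul_bilinear.1 _)) !addr0. Qed.

End TensorAlgebra.

Lemma tens_commutator (K : fieldType) (A : algType K) (x y : A) :
  let d (z : A) : tensor A A := z ⊗ 1 + 1 ⊗ z in
  d (x * y - y * x) = d x * d y - d y * d x.
Proof.
rewrite /=; have [tr tl] := @tens_bilinear K A A.
have -> : (x * y - y * x) ⊗ 1 = (x * y) ⊗ 1 - (y * x) ⊗ 1 :> tensor A A.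
  by rewrite [x * y - _]addrC [RHS]addrC; have := tl 1 (-1) (y * x) (x * y); rewrite !scaleN1r.
have -> : 1 ⊗ (x * y - y * x) = 1 ⊗ (x * y) - 1 ⊗ (y * x) :> tensor A A.
  by rewrite [x * y - _]addrC [RHS]addrC; have := tr 1 (-1) (y * x) (x * y); rewrite !scaleN1r.
rewrite !mulrDl.
rewrite !mulrDr.
rewrite !tensM.
rewrite !mul1r.
rewrite !mulr1.
move: ((x * y) ⊗ 1) ((y * x) ⊗ 1) (1 ⊗ (x * y)) (1 ⊗ (y * x)) (x ⊗ y) (y ⊗ x).
move=> p q p' q' c d.
rewrite [d + p']addrC [c + q']addrC.
rewrite [p + c + _]addrACA.
rewrite [q + d + _]addrACA.
by rewrite opprD [RHS]addrACA [d + c]addrC subrr addr0 opprD [RHS]addrACA.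
Qed.

HB.mixin Record Vector_isLie (K : fieldType) g of Vector K g := {
  lie : g -> g -> g;
  lie_bilinear : bilinear_map lie;
  liexx : forall x, lie x x = 0;
  lie_jacobi : forall x y z,
    lie x (lie y z) + lie y (lie z x) + lie z (lie x y) = 0
}.

#[short(type="lieAlgType")]
HB.structure Definition LieAlgebra (K : fieldType) :=
  {g of Vector_isLie K g & Vector K g}.

Section Semisimple.
Variables (K : fieldType) (g : lieAlgType K).
Implicit Types I : {vspace g}.

Definition is_ideal I := forall x y : g, y \in I -> lie x y \in I.

Definition derived I : {vspace g} :=
  <<[seq lie x y | x <- vbasis I, y <- vbasis I]>>%VS.

Definition solvable_ideal I := exists n, iter n derived I = 0%VS.

Definition semisimple := forall I, is_ideal I -> solvable_ideal I -> I = 0%VS.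

End Semisimple.

Definition is_lie_morphism (K : fieldType) (g : lieAlgType K) (B : algType K)
    (f : g -> B) : Prop :=
  linear f /\ forall x y, f (lie x y) = f x * f y - f y * f x.

Section Enveloping.
Variables (K : fieldType) (g : lieAlgType K).

(* The free associative algebra on the set [g]: the linearity of [g -> U(g)]
   is one of the relations imposed below. *)
Let T := {malg K[{fmonom g}]}.
Let X (x : g) : T := << fmu x >>.

Inductive env_relator : T -> Prop :=
| env_relator_lin a x y : env_relator (X (a *: x + y) - (a *: X x + X y))
| env_relator_lie x y : env_relator (X (lie x y) - (X x * X y - X y * X x)).

Inductive env_ideal : T -> Prop :=
| env_ideal_in p q s : env_relator q -> env_ideal (p * q * s).

Definition envelope := lquot env_ideal.
HB.instance Definition _ := GRing.Lmodule.on envelope.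

Let malgZAr (c : K) (p q : T) : c *: (p * q) = p * (c *: q).
Proof.
have C : c%:MP * p = p * c%:MP :> T.
  rewrite [LHS]malgM_def [RHS]malgM_def fgmulUg fgmulgU.
  by apply: eq_bigr => k _; rewrite mul1m mulm1 mulrC.
apply: (etrans (esym (mul_malgC c (p * q)))).
apply: (etrans (mulrA _ p q)); apply: (etrans (congr1 ( *%R^~ q) C)).
by apply: (etrans (esym (mulrA p _ q))); congr (_ * _); apply: mul_malgC.
Qed.

Let env_mull p q : lspan env_ideal q -> lspan env_ideal (p * q).
Proof.
elim=> [|a x y [u v w rv] _ IH]; first by rewrite mulr0; apply: lspan0.
by rewrite mulrDr -malgZAr !mulrA; apply: lspan_step IH.
Qed.

Let env_mulr p q : lspan env_ideal q -> lspan env_ideal (q * p).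
Proof.
elim=> [|a x y [u v w rv] _ IH]; first by rewrite mul0r; apply: lspan0.
by rewrite mulrDl -scalerAl -(mulrA _ w p); apply: lspan_step IH.
Qed.

Let one : envelope := lproj env_ideal 1.

Fact envelope_mul_sig : {mul : envelope -> envelope -> envelope |
  forall p q, mul (lproj env_ideal p) (lproj env_ideal q) = lproj env_ideal (p * q)}.
Proof.
exists (fun x y => lproj env_ideal (repr x * repr y)) => p q.
apply/lprojP; set p' := repr _; set q' := repr _.
have -> : p' * q' - p * q = p' * (q' - q) + (p' - p) * q.
  by rewrite mulrBr mulrBl addrA subrK.
by apply: lspanD; [apply: env_mull | apply: env_mulr]; apply: lreprP.
Qed.
Let emul := sval envelope_mul_sig.
Let emulE : forall p q, emul (lproj env_ideal p) (lproj env_ideal q) =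
    lproj env_ideal (p * q) := svalP envelope_mul_sig.

Let emulA : associative emul.
Proof.
by elim/lproj_ind=> x; elim/lproj_ind=> y; elim/lproj_ind=> z; rewrite !emulE mulrA.
Qed.
Let e1mul : left_id one emul.
Proof. by elim/lproj_ind=> x; rewrite emulE mul1r. Qed.
Let emul1 : right_id one emul.
Proof. by elim/lproj_ind=> x; rewrite emulE mulr1. Qed.
Let emulDl : left_distributive emul +%R.
Proof.
elim/lproj_ind=> x; elim/lproj_ind=> y; elim/lproj_ind=> z.
by rewrite -lprojD !emulE -lprojD mulrDl.
Qed.
Let emulDr : right_distributive emul +%R.
Proof.
elim/lproj_ind=> x; elim/lproj_ind=> y; elim/lproj_ind=> z.
by rewrite -lprojD !emulE -lprojD mulrDr.
Qed.

Section Lift.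
Variables (B : algType K) (f : g -> B).

Let word (w : {fmonom g}) : B := \prod_(x <- (w : seq g)) f x.

Definition elift (u : envelope) : B := freelift word (repr u).

Let word1 : word (@mone _) = 1. Proof. by rewrite /word fm1 big_nil. Qed.
Let wordM v w : word (mmul v w) = word v * word w.
Proof. by rewrite /word fmM big_cat. Qed.

Lemma free_word1 : freelift word (1 : T) = 1.
Proof. by rewrite freeliftU word1. Qed.

Lemma free_wordM p q : freelift word (p * q : T) = freelift word p * freelift word q.
Proof.
apply: (free_linear_eq (f := fun p => freelift word (p * q))
                       (g := fun p => freelift word p * freelift word q)).
- by move=> a x y; rewrite mulrDl -scalerAl freelift_is_linear.
- by move=> a x y; rewrite freelift_is_linear mulrDl -scalerAl.
move=> v; apply: (free_linear_eq (f := fun q => freelift word (<< v >> * q))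
                       (g := fun q => freelift word << v >> * freelift word q)).
- by move=> a x y; rewrite mulrDr -malgZAr freelift_is_linear.
- by move=> a x y; rewrite freelift_is_linear mulrDr -scalerAr.
by move=> w; rewrite malgM_def fgmulUU mulr1 !freeliftU wordM.
Qed.

Hypothesis lf : is_lie_morphism f.

Lemma free_wordX x : freelift word (X x) = f x.
Proof. by rewrite freeliftU /word fmU big_seq1. Qed.

Let free_ideal p : lspan env_ideal p -> freelift word p = 0.
Proof.
have [f_lin f_lie] := lf.
elim=> [|a x y Sx _ IH]; first exact: linear0.
rewrite freelift_is_linear IH addr0; case: Sx => u v w rv.
rewrite !free_wordM (_ : freelift word v = 0) ?mulr0 ?mul0r ?scaler0 //.
case: rv => [c x1 x2|x1 x2]; rewrite linearB /=.
  by rewrite freelift_is_linear !free_wordX f_lin subrr.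
rewrite (linearB (freelift word)) /=.
apply/eqP; rewrite subr_eq0 free_wordX f_lie; apply/eqP; congr (_ - _).
  by rewrite free_wordM !free_wordX.
by rewrite free_wordM !free_wordX.
Qed.

Lemma elift_proj p : elift (lproj env_ideal p) = freelift word p.
Proof.
apply/eqP; rewrite -subr_eq0 /elift -linearB /=; apply/eqP.
by apply: free_ideal; apply: lreprP.
Qed.
End Lift.

Let one_neq0 : one != 0.
Proof.
apply/eqP => one0.
have lf : is_lie_morphism (fun _ : g => 0 : K^o).
  by split=> [a x y|x y]; rewrite ?scaler0 ?mul0r ?subrr ?addr0.
have := elift_proj lf 1; rewrite free_word1 -/one one0.
have -> : 0 = lproj env_ideal 0 :> envelope by rewrite linear0.
by rewrite (elift_proj lf) linear0 => /esym/eqP; rewrite oner_eq0.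
Qed.

HB.instance Definition _ :=
  GRing.Zmodule_isNzRing.Build envelope emulA e1mul emul1 emulDl emulDr one_neq0.

Lemma lproj_env1 : lproj env_ideal 1 = 1 :> envelope. Proof. by []. Qed.
Lemma lproj_envM p q :
  lproj env_ideal (p * q) =
  (lproj env_ideal p : envelope) * (lproj env_ideal q : envelope).
Proof. by rewrite -emulE. Qed.

Let scaleAl (c : K) (x y : envelope) : c *: (x * y) = (c *: x) * y.
Proof.
elim/lproj_ind: x => x; elim/lproj_ind: y => y.
by rewrite -lproj_envM -!linearZ /= -lproj_envM scalerAl.
Qed.
HB.instance Definition _ :=
  GRing.Lmodule_isLalgebra.Build K envelope scaleAl.
Let scaleAr (c : K) (x y : envelope) : c *: (x * y) = x * (c *: y).
Proof.
elim/lproj_ind: x => x; elim/lproj_ind: y => y.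
by rewrite -lproj_envM -!linearZ /= -lproj_envM malgZAr.
Qed.
HB.instance Definition _ :=
  GRing.Lalgebra_isAlgebra.Build K envelope scaleAr.

End Enveloping.

HB.lock Definition uin (K : fieldType) (g : lieAlgType K) (x : g) : envelope g :=
  lproj (@env_ideal K g) << fmu x >>.

Section EnvelopingTheory.
Variables (K : fieldType) (g : lieAlgType K).
Local Notation T := {malg K[{fmonom g}]}.
Local Notation env_relator := (@env_relator K g).
Local Notation env_ideal := (@env_ideal K g).
Local Notation envelope := (envelope g).
Local Notation uin := (@uin K g).

Let uinE x : uin x = lproj env_ideal << fmu x >>.
Proof. by rewrite unlock. Qed.

Let env_ideal1 q : env_relator q -> env_ideal q.
Proof. by move=> rq; have := env_ideal_in 1 1 rq; rewrite mul1r mulr1. Qed.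

Lemma uin_lie_morphism : is_lie_morphism uin.
Proof.
split=> [a x y|x y]; rewrite !uinE.
  apply: etrans (lproj_is_linear _ _ _ _); apply/lprojP/lspan_in.
  exact/env_ideal1/env_relator_lin.
rewrite -!lproj_envM.
apply: etrans (linearB (lproj env_ideal) _ _); apply/lprojP/lspan_in.
exact/env_ideal1/env_relator_lie.
Qed.

Lemma envelope_ind (P : envelope -> Prop) : P 0 ->
  (forall a (w : seq g) u, P u -> P (a *: \prod_(x <- w) uin x + u)) ->
  forall u, P u.
Proof.
move=> P0 PS; elim/lproj_ind => p; rewrite [p]monalgE.
elim: (enum_fset _) => [|w l IH]; first by rewrite big_nil linear0.
rewrite big_cons.
have -> : << p@_w *g w >> = p@_w *: << w >> :> T.
  by apply/malgP => x; rewrite mcoeffZ !mcoeffU mulrnAr mulr1.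
rewrite lproj_is_linear.
suff -> : lproj env_ideal << w >> = \prod_(x <- (w : seq g)) uin x by apply: PS.
rewrite -[in LHS](fmK w); elim: (w : seq g) => [|x s IHs].
  by rewrite big_nil -fmoneE.
rewrite big_cons -IHs uinE -lproj_envM malgM_def fgmulUU mulr1; congr (lproj _ << _ >>).
by apply/eqP; rewrite fmP fmM fmU.
Qed.

Section LiftTheory.
Variables (B : algType K) (f : g -> B).
Hypothesis lf : is_lie_morphism f.

Lemma elift_linear : linear (elift f).
Proof.
move=> a; elim/lproj_ind => x; elim/lproj_ind => y.
by rewrite -lproj_is_linear !(elift_proj lf) freelift_is_linear.
Qed.

Lemma elift1 : elift f 1 = 1.
Proof. by rewrite -lproj_env1 (elift_proj lf) free_word1. Qed.

Lemma eliftM u v : elift f (u * v) = elift f u * elift f v.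
Proof.
elim/lproj_ind: u => x; elim/lproj_ind: v => y.
by rewrite -lproj_envM !(elift_proj lf) free_wordM.
Qed.

Lemma elift_uin x : elift f (uin x) = f x.
Proof. by rewrite uinE (elift_proj lf) free_wordX. Qed.

End LiftTheory.
End EnvelopingTheory.

Section EnvelopeHopf.
Variables (K : fieldType) (g : lieAlgType K).
Local Notation U := (envelope g).
Local Notation UU := (tensor U U).

Lemma zero_lie_morphism : is_lie_morphism (fun _ : g => 0 : K^o).
Proof. by split=> [a x y|x y]; rewrite ?scaler0 ?mul0r ?subrr ?addr0. Qed.

Definition counit (u : U) : K := elift (fun _ : g => 0 : K^o) u.

Lemma counit_linear : linear (counit : U -> K^o).
Proof. exact: elift_linear zero_lie_morphism. Qed.

Let UU_one_neq0 : (1 : UU) != 0.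
Proof.
pose b (u v : U) : K^o := counit u * counit v.
have bb : bilinear_map b.
  split=> [u a v w|v a u w]; rewrite /b.
    by rewrite counit_linear mulrDr scalerAr.
  by rewrite counit_linear mulrDl scalerAl.
apply/eqP => E; have := tliftE 1 1 bb.
have -> : (1 : U) ⊗ (1 : U) = 0 by exact: E.
rewrite (linear_map0 (tlift_linear bb)) /b /counit (elift1 zero_lie_morphism).
by rewrite mulr1 => /esym/eqP; rewrite oner_eq0.
Qed.

HB.instance Definition _ := GRing.PzSemiRing_isNonZero.Build UU UU_one_neq0.
HB.instance Definition _ :=
  GRing.Lmodule_isLalgebra.Build K UU (@tens_scalerAl K U U).
HB.instance Definition _ :=
  GRing.Lalgebra_isAlgebra.Build K UU (@tens_scalerAr K U U).

Definition comult_gen (x : g) : UU := uin x ⊗ 1 + 1 ⊗ uin x.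

Lemma comult_lie_morphism : is_lie_morphism comult_gen.
Proof.
have [ul uL] := uin_lie_morphism g; have [tr tl] := @tens_bilinear K U U.
have linD (Z : lmodType K) (f1 f2 : U -> Z) : linear f1 -> linear f2 ->
    linear (fun x => f1 (uin x) + f2 (uin x)).
  by move=> l1 l2 a x y; rewrite ul l1 l2 scalerDr addrACA.
split=> [|x y]; first exact: linD (tl 1) (tr 1).
by rewrite /comult_gen uL; apply: tens_commutator.
Qed.

Definition comult (u : U) : UU := elift comult_gen u.

(* The antipode is the antiautomorphism with S(x) = -x for x in g. *)
Definition antipode (u : U) : U :=
  freelift (fun w : {fmonom g} => \prod_(x <- rev (w : seq g)) - uin x) (repr u).

Lemma comult_linear : linear comult.
Proof. exact: elift_linear comult_lie_morphism. Qed.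
Lemma comult1 : comult 1 = 1.
Proof. exact: elift1 comult_lie_morphism. Qed.
Lemma comultM u v : comult (u * v) = comult u * comult v.
Proof. exact: eliftM comult_lie_morphism _ _. Qed.
Lemma comult_uin x : comult (uin x) = uin x ⊗ 1 + 1 ⊗ uin x.
Proof. exact: elift_uin comult_lie_morphism x. Qed.

End EnvelopeHopf.

Section RMatrix.
Variables (K : fieldType) (g : lieAlgType K).
Implicit Types r q : tensor g g.

(* [wedge^2 g] is the space of skew-symmetric tensors in g ⊗ g. *)
Definition skew r : Prop := tlift (fun x y => y ⊗ x) r = - r.

(* [r12, q13] + [r12, q23] + [r13, q23], evaluated in g ⊗ (g ⊗ g) *)
Definition yang_baxter r q : tensor g (tensor g g) :=
  tlift (fun x y => tlift (fun x' y' =>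
    lie x x' ⊗ (y ⊗ y') + x ⊗ (lie y x' ⊗ y') + x ⊗ (x' ⊗ lie y y')) q) r.

(* The Schouten bracket on [wedge^2 g].  The normalization (in particular the
   sign) is the one for which the Schouten bracket of the bracket
   a, b |-> (r1 a)(r2 b) with itself is the action of [schouten_wedge2 r r]. *)
Definition schouten_wedge2 r q : tensor g (tensor g g) :=
  - (yang_baxter r q + yang_baxter q r).

Definition ad3 (x : g) : tensor g (tensor g g) -> tensor g (tensor g g) :=
  tlift (fun y => tlift (fun z w =>
    lie x y ⊗ (z ⊗ w) + y ⊗ (lie x z ⊗ w) + y ⊗ (z ⊗ lie x w))).

Definition classical_r_matrix r : Prop :=
  skew r /\ forall x, ad3 x (schouten_wedge2 r r) = 0.

End RMatrix.

(* An element of V[[h]] is the sequence of its coefficients; an element of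
   V[[t,h]] is a function of two indices, [v i j] being the coefficient of
   t^i h^j. *)

Notation fps V := (nat -> V) (only parsing).
Notation fps2 V := (nat -> nat -> V) (only parsing).

Section PowerSeries.
Variable V : zmodType.

Definition fps_const (v : V) : fps V := fun n => if n is 0 then v else 0.

(* \sum_k h^k c_k *)
Definition fps_sum (c : nat -> fps V) : fps V :=
  fun n => \sum_(k < n.+1) c k (n - k)%N.

Definition fps2_const (v : V) : fps2 V :=
  fun i j => if (i, j) is (0, 0) then v else 0.

(* \sum_k h^k c_k *)
Definition fps2_sum (c : nat -> fps2 V) : fps2 V :=
  fun i j => \sum_(k < j.+1) c k i (j - k)%N.

(* V[[t]] and V[[h]] inside V[[t,h]] *)
Definition fps_in_t (v : fps V) : fps2 V :=
  fun i j => if j is 0 then v i else 0.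
Definition fps_in_h (v : fps V) : fps2 V :=
  fun i j => if i is 0 then v j else 0.

End PowerSeries.

Definition fps_scale (K : fieldType) (V : lmodType K) (c : fps K) (v : fps V) :
    fps V :=
  fun n => \sum_(i < n.+1) c i *: v (n - i)%N.

Definition fps2_scale (K : fieldType) (V : lmodType K) (c : fps2 K)
    (v : fps2 V) : fps2 V :=
  fun i j => \sum_(k < i.+1) \sum_(l < j.+1) c k l *: v (i - k)%N (j - l)%N.

Definition fps_mul (B : pzRingType) (u v : fps B) : fps B :=
  fun n => \sum_(i < n.+1) u i * v (n - i)%N.

(* A K[[h]]-linear map V[[h]] -> W[[h]] is automatically h-adically continuous,
   hence determined by its restriction [f] to V. *)
Definition fps_ext (K : fieldType) (V W : lmodType K) (f : V -> fps W)
  (v : fps V) : fps W := fps_sum (fun k => f (v k)).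

(* Topological Hopf algebra structures over K[[h]] on the algebra B[[h]]; the
   completed tensor square of B[[h]] is (B ⊗ B)[[h]], and the structure maps are
   given by their restrictions to B. *)
Record topological_hopf (K : fieldType) (B : algType K)
    (D : B -> fps (tensor B B)) (e : B -> fps K^o) (S : B -> fps B) : Prop := {
  th_comult_linear : linear D;
  th_counit_linear : linear e;
  th_antipode_linear : linear S;
  th_comult1 : D 1 = fps_const 1;
  th_comultM : forall x y, D (x * y) = fps_mul (D x) (D y);
  th_counit1 : e 1 = fps_const 1;
  th_counitM : forall x y, e (x * y) = fps_mul (e x) (e y);
  th_coassoc : forall x,
    fps_ext (tlift (fun u v n =>
      tlift (fun u' u'' => u' ⊗ (u'' ⊗ v)) (D u n))) (D x) =
    fps_ext (tlift (fun u v n => u ⊗ D v n)) (D x);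
  th_counitl : forall x,
    fps_ext (tlift (fun u v n => (e u n : K) *: v)) (D x) = fps_const x;
  th_counitr : forall x,
    fps_ext (tlift (fun u v n => (e v n : K) *: u)) (D x) = fps_const x;
  th_antipodel : forall x,
    fps_ext (tlift (fun u v n => S u n * v)) (D x) = fun n => (e x n : K)%:A;
  th_antipoder : forall x,
    fps_ext (tlift (fun u v n => u * S v n)) (D x) = fun n => (e x n : K)%:A
}.

(* U_h(g) is identified, as an algebra, with U(g)[[h]].  That the cobracket
   (Delta_h - Delta_h^op)/h mod h is x |-> [r, Delta(x)] follows from the form
   of [qg_F] and the skew-symmetry of r. *)
Record quantum_group (K : fieldType) (g : lieAlgType K) (r : tensor g g) :=
    QuantumGroup {
  qg_F : fps (tensor (envelope g) (envelope g));
  qg_Finv : fps (tensor (envelope g) (envelope g));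
  qg_counit : envelope g -> fps K^o;
  qg_antipode : envelope g -> fps (envelope g);
  qg_comult : envelope g -> fps (tensor (envelope g) (envelope g)) :=
    fun x => fps_mul (fps_mul qg_F (fps_const (comult x))) qg_Finv;
  qg_FK : fps_mul qg_F qg_Finv = fps_const 1;
  qg_KF : fps_mul qg_Finv qg_F = fps_const 1;
  qg_F0 : qg_F 0%N = 1;
  qg_F1 : qg_F 1%N = 2^-1 *: tlift (fun x y => uin x ⊗ uin y) r;
  qg_hopf : topological_hopf qg_comult qg_counit qg_antipode;
  qg_comult0 : forall x, qg_comult x 0%N = comult x;
  qg_counit0 : forall x, qg_counit x 0%N = counit x;
  qg_antipode0 : forall x, qg_antipode x 0%N = antipode x
}.

Section Invariant.
Variables (K : fieldType) (g : lieAlgType K).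
Local Notation U := (envelope g).

(* m T (a ⊗ b), for T in U ⊗ U *)
Definition mul_act (A : lmodType K) (act : U -> A -> A) (m : A -> A -> A)
    (T : tensor U U) (a b : A) : A :=
  tlift (fun u v => m (act u a) (act v b)) T.

Variable A : lmodType K.
Implicit Types (act : U -> A -> A) (mu f s : A -> A -> A).

Definition is_invariant act f : Prop :=
  forall x a b, act x (f a b) = mul_act act f (comult x) a b.

(* An algebra need not have a unit. *)
Record invariant_algebra act mu : Prop := {
  ia_mul_bilinear : bilinear_map mu;
  ia_mulA : associative mu;
  ia_act_bilinear : bilinear_map act;
  ia_act1 : forall a, act 1 a = a;
  ia_actM : forall u v a, act (u * v) a = act u (act v a);
  ia_invariant : is_invariant act mu
}.

Record is_bracket mu f : Prop := {
  br_bilinear : bilinear_map f;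
  br_skew : forall a b, f a b = - f b a;
  br_leibnizl : forall a b c, f (mu a b) c = mu a (f b c) + mu (f a c) b;
  br_leibnizr : forall a b c, f a (mu b c) = mu (f a b) c + mu b (f a c)
}.

Definition r_bracket act mu (r : tensor g g) (a b : A) : A :=
  tlift (fun x y => mu (act (uin x) a) (act (uin y) b)) r.

Definition trivector act mu (phi : tensor g (tensor g g)) (a b c : A) : A :=
  tlift (fun x => tlift (fun y z =>
    mu (mu (act (uin x) a) (act (uin y) b)) (act (uin z) c))) phi.

Definition schouten f s (a b c : A) : A :=
  let J a b c := f (s a b) c + s (f a b) c in
  J a b c + J b c a + J c a b.

Record quantization1 mu (m : fps A -> fps A -> fps A) : Prop := {
  q1_addl : forall (a a' b : fps A), m (a + a') b = m a b + m a' b;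
  q1_addr : forall (a b b' : fps A), m a (b + b') = m a b + m a b';
  q1_scalel : forall c a b, m (fps_scale c a) b = fps_scale c (m a b);
  q1_scaler : forall c a b, m a (fps_scale c b) = fps_scale c (m a b);
  q1_mulA : associative m;
  q1_mod : forall a b, m (fps_const a) (fps_const b) 0%N = mu a b
}.

Record quantization2 mu (m : fps2 A -> fps2 A -> fps2 A) : Prop := {
  q2_addl : forall (a a' b : fps2 A), m (a + a') b = m a b + m a' b;
  q2_addr : forall (a b b' : fps2 A), m a (b + b') = m a b + m a b';
  q2_scalel : forall c a b, m (fps2_scale c a) b = fps2_scale c (m a b);
  q2_scaler : forall c a b, m a (fps2_scale c b) = fps2_scale c (m a b);
  q2_mulA : associative m;
  q2_mod : forall a b, m (fps2_const a) (fps2_const b) 0%N 0%N = mu a b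
}.

Definition poisson_bracket (m : fps A -> fps A -> fps A) (a b : A) : A :=
  m (fps_const a) (fps_const b) 1%N - m (fps_const b) (fps_const a) 1%N.

(* The quotients A_{t,0} = A_{t,h} / h and A_{0,h} = A_{t,h} / t *)
Definition at_h0 (m : fps2 A -> fps2 A -> fps2 A) (a b : fps A) : fps A :=
  fun i => m (fps_in_t a) (fps_in_t b) i 0%N.
Definition at_t0 (m : fps2 A -> fps2 A -> fps2 A) (a b : fps A) : fps A :=
  fun j => m (fps_in_h a) (fps_in_h b) 0%N j.

Definition fps_act act (x : U) (a : fps A) : fps A := fun n => act x (a n).
Definition fps2_act act (x : U) (a : fps2 A) : fps2 A :=
  fun i j => act x (a i j).

Definition U_invariant1 act (m : fps A -> fps A -> fps A) : Prop :=
  forall x a b, fps_act act x (m a b) = mul_act (fps_act act) m (comult x) a b.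

Variables (r : tensor g g) (Q : quantum_group r).

Definition Uh_invariant1 act (m : fps A -> fps A -> fps A) : Prop :=
  forall x a b, fps_act act x (m a b) =
    fps_sum (fun k => mul_act (fps_act act) m (qg_comult Q x k) a b).

Definition Uh_invariant2 act (m : fps2 A -> fps2 A -> fps2 A) : Prop :=
  forall x a b, fps2_act act x (m a b) =
    fps2_sum (fun k => mul_act (fps2_act act) m (qg_comult Q x k) a b).

End Invariant.

(* Main.v *)
(** Write c01 and c10 for the coefficients of h and t in the product of
    constants.  The order h part of the U_h(g)-invariance says that
    2 c01 + {,}_r is U(g)-invariant, because Delta_h = Delta + h/2 [r, Delta] + ...;
    hence so is f = p + {,}_r, half of its skew part.  The Jacobi identity of the
    commutator of A_{t,h} gives [[p,p]] = 0 at order h^2 and [[p,s]] = 0 at order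
    th.  Since {,}_r has Schouten bracket zero with every U(g)-invariant bracket,
    substituting p = f - {,}_r yields [[f,f]] = -[[{,}_r,{,}_r]] = -phi_A and
    [[f,s]] = 0. *)

Require Import Defs.
From mathcomp Require Import all_boot all_order all_algebra.
From mathcomp Require Import boolp functions reals.
From mathcomp.real_closed Require Import complex.

Set Implicit Arguments.
Unset Strict Implicit.
Unset Printing Implicit Defensive.

Import GRing.Theory.
Local Open Scope ring_scope.

(** * Reflexive decision procedure for identities in abelian groups *)

Section ZmodReflection.

Inductive zterm := ZVar of nat | ZZero | ZAdd of zterm & zterm | ZOpp of zterm.

Variable V : zmodType.
Implicit Types (env : seq V) (t : zterm).

Fixpoint zeval env t : V :=
  match t with
  | ZVar i => env`_i
  | ZZero => 0
  | ZAdd t1 t2 => zeval env t1 + zeval env t2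
  | ZOpp t1 => - zeval env t1
  end.

(** The positive and the negative occurrences of variables, with no cancellation performed. *)
Fixpoint zsplit t : seq nat * seq nat :=
  match t with
  | ZVar i => ([:: i], [::])
  | ZZero => ([::], [::])
  | ZAdd t1 t2 =>
      ((zsplit t1).1 ++ (zsplit t2).1, (zsplit t1).2 ++ (zsplit t2).2)
  | ZOpp t1 => ((zsplit t1).2, (zsplit t1).1)
  end.

Lemma zevalE env t : zeval env t =
  \sum_(i <- (zsplit t).1) env`_i - \sum_(i <- (zsplit t).2) env`_i.
Proof.
elim: t => [i||t1 IH1 t2 IH2|t1 IH1] /=.
- by rewrite big_seq1 big_nil subr0.
- by rewrite !big_nil subr0.
- by rewrite !big_cat IH1 IH2 opprD addrACA.
- by rewrite IH1 opprB.
Qed.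

(** Moving the negative occurrences across the equation leaves two sums of variables, compared as
    multisets. A variable that cancels inside one term occurs in both multisets, so cancellation
    needs no separate treatment. *)
Lemma zmod_reflect env t1 t2 :
  perm_eq ((zsplit t1).1 ++ (zsplit t2).2) ((zsplit t2).1 ++ (zsplit t1).2) ->
  zeval env t1 = zeval env t2.
Proof.
move=> E; apply/eqP; rewrite !zevalE subr_eq addrAC eq_sym subr_eq; apply/eqP.
by rewrite -!big_cat /= (perm_big _ E).
Qed.

End ZmodReflection.

Ltac zmem x env :=
  lazymatch env with
  | nil => constr:(false)
  | x :: _ => constr:(true)
  | _ :: ?env' => zmem x env'
  end.
Ltac zindex x env :=
  lazymatch env with
  | x :: _ => constr:(O)
  | _ :: ?env' => let n := zindex x env' in constr:(S n)
  end.
Ltac zatoms t env :=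
  lazymatch t with
  | 0 => env
  | ?a + ?b => let env' := zatoms a env in zatoms b env'
  | - ?a => zatoms a env
  | _ => let m := zmem t env in
    lazymatch m with true => env | false => constr:(t :: env) end
  end.
Ltac zreify t env :=
  lazymatch t with
  | 0 => constr:(ZZero)
  | ?a + ?b =>
    let a' := zreify a env in let b' := zreify b env in constr:(ZAdd a' b')
  | - ?a => let a' := zreify a env in constr:(ZOpp a')
  | _ => let i := zindex t env in constr:(ZVar i)
  end.
Ltac zmod :=
  lazymatch goal with
  | |- @eq ?T ?a ?b =>
    let env := zatoms a (@nil T) in
    let env := zatoms b env in
    let ta := zreify a env in
    let tb := zreify b env in
    apply: (@zmod_reflect _ env ta tb); vm_compute; reflexivity
  end.

(** * Calculus of maps lifted from two arguments to tensors *)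

Section TensorLifts.
Variables (K : fieldType) (V W : lmodType K).
Implicit Type t : tensor V W.

(** A lift is a finite sum over the chosen representative of the tensor, and [L] passes through
    finite sums. *)
Lemma linear_tlift (Z Z' : lmodType K) (L : Z -> Z') (b : V -> W -> Z) t :
  linear L -> L (tlift b t) = tlift (fun v w => L (b v w)) t.
Proof.
move=> lL; rewrite /tlift /freelift.
elim/big_rec2: _ => [|k y1 y2 _ <-]; first exact: linear_map0.
by rewrite lL.
Qed.

Lemma eq_tlift (Z : lmodType K) (b b' : V -> W -> Z) t :
  (forall v w, b v w = b' v w) -> tlift b t = tlift b' t.
Proof. by move=> E; apply: eq_bigr => k _; rewrite E. Qed.

Lemma tliftD (Z : lmodType K) (b b' : V -> W -> Z) t :
  tlift (fun v w => b v w + b' v w) t = tlift b t + tlift b' t.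
Proof.
by rewrite (@tlift_comb _ _ _ _ 1 _ b b') ?scale1r // => v w; rewrite scale1r.
Qed.

Lemma tlift0 (Z : lmodType K) t : tlift (fun _ _ => 0 : Z) t = 0.
Proof. by rewrite /tlift /freelift big1 // => k _; rewrite scaler0. Qed.

Lemma tliftN (Z : lmodType K) (b : V -> W -> Z) t :
  tlift (fun v w => - b v w) t = - tlift b t.
Proof.
rewrite (@tlift_comb _ _ _ _ (-1) _ b (fun _ _ => 0)) ?tlift0 => [|v w];
  by rewrite scaleN1r addr0.
Qed.

Lemma tlift_tlift (V' W' Z : lmodType K) (b : V' -> W' -> Z)
    (c : V -> W -> tensor V' W') t : bilinear_map b ->
  tlift b (tlift c t) = tlift (fun v w => tlift b (c v w)) t.
Proof. by move=> bb; apply/linear_tlift/tlift_linear. Qed.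

(** Both sides are the same finite double sum, up to the order of summation. *)
Lemma tlift_exchange (V' W' Z : lmodType K) (b : V -> W -> V' -> W' -> Z)
    t (t' : tensor V' W') :
  tlift (fun v w => tlift (b v w) t') t =
  tlift (fun v' w' => tlift (fun v w => b v w v' w') t) t'.
Proof.
rewrite /tlift /freelift; under eq_bigr => k _ do rewrite scaler_sumr.
rewrite exchange_big /=; apply: eq_bigr => k _; rewrite scaler_sumr.
by apply: eq_bigr => l _; rewrite !scalerA mulrC.
Qed.

End TensorLifts.

(** * Sign rule for skew-symmetric tensors *)

Section SkewTensors.
Variables (K : fieldType) (g : lieAlgType K) (r : tensor g g).
Hypothesis skew_r : Defs.skew r.

Lemma tlift_skew (Z : lmodType K) (b : g -> g -> Z) : bilinear_map b ->
  tlift (fun x y => b y x) r = - tlift b r.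
Proof.
move=> bb; have lb := tlift_linear bb.
have lbN : tlift b (- r) = - tlift b r.
  by have := lb (-1) r 0; rewrite (linear_map0 lb) !addr0 !scaleN1r.
rewrite -lbN -skew_r tlift_tlift //; apply: eq_tlift => x y.
by rewrite tliftE.
Qed.

End SkewTensors.

(** * Elementary rules for bilinear maps *)

Section BilinearMaps.
Variables (K : fieldType) (V W Z : lmodType K) (b : V -> W -> Z).
Hypothesis bb : bilinear_map b.

Lemma bilDl v v' w : b (v + v') w = b v w + b v' w.
Proof. by have := bb.2 w 1 v v'; rewrite !scale1r. Qed.
Lemma bilDr v w w' : b v (w + w') = b v w + b v w'.
Proof. by have := bb.1 v 1 w w'; rewrite !scale1r. Qed.
Lemma bil0l w : b 0 w = 0. Proof. exact: linear_map0 (bb.2 w). Qed.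
Lemma bil0r v : b v 0 = 0. Proof. exact: linear_map0 (bb.1 v). Qed.
Lemma bilZl c v w : b (c *: v) w = c *: b v w.
Proof. by have := bb.2 w c v 0; rewrite bil0l !addr0. Qed.
Lemma bilZr c v w : b v (c *: w) = c *: b v w.
Proof. by have := bb.1 v c w 0; rewrite bil0r !addr0. Qed.
Lemma bilNl v w : b (- v) w = - b v w.
Proof. by rewrite -scaleN1r bilZl scaleN1r. Qed.
Lemma bilNr v w : b v (- w) = - b v w.
Proof. by rewrite -scaleN1r bilZr scaleN1r. Qed.

Lemma bilinear_map_flip : bilinear_map (fun w v => b v w).
Proof. by split; [exact: bb.2 | exact: bb.1]. Qed.

Lemma bilinear_mapD (b' : V -> W -> Z) : bilinear_map b' ->
  bilinear_map (fun v w => b v w + b' v w).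
Proof.
move=> bb'; split=> [v|w] c x y.
  by rewrite bb.1 bb'.1 scalerDr addrACA.
by rewrite bb.2 bb'.2 scalerDr addrACA.
Qed.

Lemma bilinear_mapZ c : bilinear_map (fun v w => c *: b v w).
Proof.
split=> [v|w] d x y.
  by rewrite bb.1 scalerDr !scalerA mulrC.
by rewrite bb.2 scalerDr !scalerA mulrC.
Qed.

Lemma bilinear_mapN : bilinear_map (fun v w => - b v w).
Proof.
split=> [v|w] d x y; first by rewrite bb.1 opprD scalerN.
by rewrite bb.2 opprD scalerN.
Qed.

End BilinearMaps.

(** * Brackets from first-order deformations of a commutative product *)

Section SkewPart.
Variables (K : fieldType) (A : lmodType K).
Implicit Types b mu : A -> A -> A.

Definition skew_part b (x y : A) : A := b x y - b y x.

Lemma skew_part_bilinear b : bilinear_map b -> bilinear_map (skew_part b).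
Proof.
by move=> bb; apply: bilinear_mapD => //; apply/bilinear_mapN/bilinear_map_flip.
Qed.

(* [cocycle] is the coefficient of the parameter in the associativity of a
   first-order deformation [mu + h b]. *)
Lemma skew_part_bracket mu b : commutative mu -> bilinear_map mu ->
  bilinear_map b ->
  (forall x y z, b (mu x y) z + mu (b x y) z = b x (mu y z) + mu x (b y z)) ->
  is_bracket mu (skew_part b).
Proof.
move=> muC bmu bb cocycle.
have sk x y : skew_part b x y = - skew_part b y x by rewrite opprB.
have L x y z : skew_part b (mu x y) z =
    mu x (skew_part b y z) + mu (skew_part b x z) y.
  (* In [E1 - E2 + E3] the terms [b x (mu y z)], [b (mu x z) y] and [mu (b x y) z] cancel by
     commutativity of [mu]; what remains is the Leibniz rule. *)
  have E1 := cocycle x y z; have E2 := cocycle x z y; have E3 := cocycle z x y.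
  rewrite (muC x (b y z)) in E1; rewrite (muC x (b z y)) (muC z y) in E2.
  rewrite (muC z x) (muC z (b x y)) in E3.
  rewrite /skew_part (muC x (_ - _)) !(bilDl bmu) !(bilNl bmu).
  rewrite -[b (mu x y) z](addrK (mu (b x y) z)) E1.
  rewrite -[b z (mu x y)](addrK (mu (b x y) z)) -E3.
  rewrite -[b x (mu y z)](addrK (mu (b z y) x)) -E2.
  zmod.
split=> //; first exact: skew_part_bilinear.
move=> x y z; rewrite sk L opprD -(bilNr bmu) -(bilNl bmu) -!sk.
by rewrite addrC.
Qed.

End SkewPart.

(** * Action of tensors over U(g) on bilinear maps, and invariance *)

Section InvariantMaps.
Variables (K : fieldType) (g : lieAlgType K) (A : lmodType K).
Local Notation U := (envelope g).
Variable act : U -> A -> A.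
Hypotheses (act_bil : bilinear_map act) (act1 : forall a, act 1 a = a)
  (actM : forall u v a, act (u * v) a = act u (act v a)).
Implicit Types f : A -> A -> A.

Lemma mul_act_in_bilinear f a b : bilinear_map f ->
  bilinear_map (fun u v => f (act u a) (act v b)).
Proof.
move=> bf; split=> [u|v] c x y.
  by rewrite act_bil.2 bf.1.
by rewrite act_bil.2 bf.2.
Qed.

Lemma mul_act_linear f a b : bilinear_map f ->
  linear (fun T => mul_act act f T a b).
Proof. by move=> bf; apply/tlift_linear/mul_act_in_bilinear. Qed.

Lemma mul_act_pure f u v a b : bilinear_map f ->
  mul_act act f (u ⊗ v) a b = f (act u a) (act v b).
Proof. by move=> bf; rewrite /mul_act tliftE //; apply: mul_act_in_bilinear. Qed.

Lemma mul_act_bilinear f T : bilinear_map f -> bilinear_map (mul_act act f T).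
Proof.
move=> bf; split=> [a|b] c x y; apply: tlift_comb => u v.
  by rewrite act_bil.1 bf.1.
by rewrite act_bil.1 bf.2.
Qed.

Lemma mul_act1 f a b : bilinear_map f -> mul_act act f 1 a b = f a b.
Proof. by move=> bf; rewrite (mul_act_pure 1 1) // !act1. Qed.

(** In a left action [T] acts first, so [S] is absorbed into the map. By linearity in [T] and [S]
    only pure tensors matter, where this is [actM]. *)
Lemma mul_actM f S T a b : bilinear_map f ->
  mul_act act f (S * T) a b = mul_act act (mul_act act f S) T a b.
Proof.
move=> bf; have lf a' b' := mul_act_linear a' b' bf.
have bS S' := mul_act_bilinear S' bf.
elim/tensor_ind: T => [|c u v T IH].
  by rewrite mulr0 (linear_map0 (lf a b)) (linear_map0 (mul_act_linear a b (bS S))).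
rewrite mulrDr -scalerAr lf IH (mul_act_linear a b (bS S)) mul_act_pure //.
congr (_ *: _ + _); elim/tensor_ind: S {IH} => [|d u' v' S IH].
  by rewrite mul0r !(linear_map0 (lf _ _)).
by rewrite mulrDl -scalerAl !lf IH tensM !mul_act_pure // !actM.
Qed.

Lemma mul_act_comult_uin f x a b : bilinear_map f ->
  mul_act act f (comult (uin x)) a b =
  f (act (uin x) a) b + f a (act (uin x) b).
Proof.
move=> bf; have := mul_act_linear a b bf 1 (uin x ⊗ 1) (1 ⊗ uin x).
by rewrite !scale1r comult_uin => ->; rewrite !mul_act_pure // !act1.
Qed.

(** Words in elements of g span U(g), and [comult] is multiplicative, so invariance follows by
    induction on words from the derivation rule on g. *)
Lemma is_invariant_uin f : bilinear_map f ->
  is_invariant act f <-> forall x a b,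
    act (uin x) (f a b) = f (act (uin x) a) b + f a (act (uin x) b).
Proof.
move=> bf; split=> [inv x a b|inv u a b].
  by rewrite inv mul_act_comult_uin.
elim/envelope_ind: u => [|c w u IH].
  rewrite (bil0l act_bil) (linear_map0 (@comult_linear K g)).
  by rewrite (linear_map0 (mul_act_linear a b bf)).
rewrite act_bil.2 comult_linear (mul_act_linear a b bf) IH.
congr (_ *: _ + _) => {c u IH}; elim: w => [|x w IH].
  by rewrite big_nil act1 comult1 mul_act1.
rewrite big_cons actM IH comultM mul_actM // linear_tlift; last exact: act_bil.1.
by apply: eq_tlift => u v; rewrite mul_act_comult_uin.
Qed.

(** The coproduct of an element of g is symmetric, so the derivation rule survives exchanging the
    two arguments. *)
Lemma is_invariant_skew_part f : bilinear_map f ->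
  is_invariant act f -> is_invariant act (skew_part f).
Proof.
move=> bf /(is_invariant_uin bf) inv.
apply/is_invariant_uin; first exact: skew_part_bilinear.
move=> x a b; rewrite /skew_part (bilDr act_bil) (bilNr act_bil) !inv; zmod.
Qed.

End InvariantMaps.

(** * Power series in two variables and linear maps between them *)

Section PowerSeriesMaps.
Variables (K : fieldType) (A : lmodType K).

(** The monomial [t^k h^l]; scaling by it shifts coefficients. *)
Definition fps2_monomial k l : nat -> nat -> K :=
  fun i j => ((i == k) && (j == l))%:R.

Lemma fps2_monomial_scale k l (u : nat -> nat -> A) i j :
  fps2_scale (fps2_monomial k l) u i j =
  if (k <= i)%N && (l <= j)%N then u (i - k)%N (j - l)%N else 0.
Proof.
rewrite /fps2_scale (eq_bigr (fun k' : 'I_i.+1 =>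
  if k' == k :> nat then if (l <= j)%N then u (i - k')%N (j - l)%N else 0 else 0)).
  by rewrite -big_mkcond (@big_ord1_eq _ _ _ (fun k' =>
    if (l <= j)%N then u (i - k')%N (j - l)%N else 0)) ltnS;
    case: (k <= i)%N; case: (l <= j)%N.
move=> k' _; rewrite (eq_bigr (fun l' : 'I_j.+1 =>
  if l' == l :> nat then if k' == k :> nat then u (i - k')%N (j - l')%N else 0 else 0)).
  rewrite -big_mkcond (@big_ord1_eq _ _ _ (fun l' =>
    if k' == k :> nat then u (i - k')%N (j - l')%N else 0)) ltnS.
  by case: (l <= j)%N; case: (k' == k :> nat).
move=> l' _; rewrite /fps2_monomial; do 2!case: eqP => _;
  by rewrite ?scale1r ?scale0r.
Qed.

Lemma fps2_sum_coef I (s : seq I) (F : I -> nat -> nat -> A) i j :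
  (\sum_(k <- s) F k) i j = \sum_(k <- s) F k i j.
Proof. by elim/big_rec2: _ => // k x y _ <-. Qed.

(** A truncation of [u] plus remainders divisible by [t^(i+1)] and [h^(j+1)]: this replaces any
    continuity argument for linear maps. *)
Lemma fps2_split (u : nat -> nat -> A) i j :
  exists u1 u2 : nat -> nat -> A, u =
  \sum_(k < i.+1) \sum_(l < j.+1)
    fps2_scale (fps2_monomial k l) (fps2_const (u k l)) +
  fps2_scale (fps2_monomial i.+1 0) u1 + fps2_scale (fps2_monomial 0 j.+1) u2.
Proof.
exists (fun p q => u (p + i.+1)%N q).
(* The first remainder already holds all terms of t-degree above [i]; the test keeps them from being
   counted twice. *)
exists (fun p q => if (p <= i)%N then u p (q + j.+1)%N else 0).
apply/funext => p; apply/funext => q.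
have -> : forall v w z : nat -> nat -> A, (v + w + z) p q = v p q + w p q + z p q by [].
rewrite fps2_sum_coef !fps2_monomial_scale leq0n /= subn0 andbT.
rewrite (eq_bigr (fun k : 'I_i.+1 =>
  if k == p :> nat then if (q < j.+1)%N then u k q else 0 else 0)) => [|k _].
  rewrite -big_mkcond (@big_ord1_eq _ _ _ (fun k =>
    if (q < j.+1)%N then u k q else 0)) !ltnS subn0.
  case: (leqP p i) => pi; case: (leqP q j) => qj;
    rewrite ?addr0 ?add0r ?subnK //.
rewrite fps2_sum_coef (eq_bigr (fun l : 'I_j.+1 =>
  if l == q :> nat then if k == p :> nat then u k l else 0 else 0)) => [|l _].
  rewrite -big_mkcond (@big_ord1_eq _ _ _ (fun l =>
    if k == p :> nat then u k l else 0)).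
  by case: (q < j.+1)%N; case: (k == p :> nat).
rewrite fps2_monomial_scale /fps2_const.
case: (ltngtP k p) => [kp|kp|->]; rewrite ?if_same //; last first.
  rewrite subnn; case: (ltngtP l q) => [lq|//|->]; last by rewrite subnn.
  by case: (q - l)%N (subn_gt0 l q) => [|n]; rewrite ?lq.
by case: (p - k)%N (subn_gt0 k p) => [|n]; rewrite ?kp //; case: (l <= q)%N.
Qed.

(* A K[[t,h]]-linear map is automatically continuous. *)
Lemma fps2_linear_coef (T : (nat -> nat -> A) -> nat -> nat -> A) :
  (forall u v : nat -> nat -> A, T (u + v) = T u + T v) ->
  (forall c u, T (fps2_scale c u) = fps2_scale c (T u)) ->
  forall u i j, T u i j =
    \sum_(k < i.+1) \sum_(l < j.+1) T (fps2_const (u k l)) (i - k)%N (j - l)%N.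
Proof.
move=> TD TZ u i j.
have T0 : T 0 = 0 by apply: (addrI (T 0)); rewrite -TD !addr0.
have [u1 [u2 {1}->]] := fps2_split u i j.
rewrite !TD !TZ.
have -> : forall v w z : nat -> nat -> A, (v + w + z) i j = v i j + w i j + z i j by [].
(* By linearity the images of the remainders are still divisible by [t^(i+1)] and [h^(j+1)], so they
   vanish at index [(i, j)]. *)
rewrite !fps2_monomial_scale !ltnn andbF /= !addr0.
rewrite (big_morph T TD T0) fps2_sum_coef; apply: eq_bigr => k _.
rewrite (big_morph T TD T0) fps2_sum_coef; apply: eq_bigr => l _.
by rewrite TZ fps2_monomial_scale !leq_ord.
Qed.

Lemma fps_in_h_const (a : A) : fps_in_h (fps_const a) = fps2_const a.
Proof. by apply/funext => -[|i]; apply/funext => -[|j]. Qed.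

Lemma fps_in_t_const (a : A) : fps_in_t (fps_const a) = fps2_const a.
Proof. by apply/funext => -[|i]; apply/funext => -[|j]. Qed.

Lemma fps_in_hD (a b : nat -> A) : fps_in_h (a + b) = fps_in_h a + fps_in_h b.
Proof.
apply/funext => -[|i]; apply/funext => j //=.
by rewrite !addrfctE /= addr0.
Qed.

Lemma fps2_scale_in_h (c : nat -> K) (u : nat -> nat -> A) j :
  fps2_scale (fps_in_h c) u 0%N j = fps_scale c (u 0%N) j.
Proof. by rewrite /fps2_scale big_ord1. Qed.

Lemma fps_in_hZ (c : nat -> K) (a : nat -> A) :
  fps_in_h (fps_scale c a) = fps2_scale (fps_in_h c) (fps_in_h a).
Proof.
apply/funext => -[|i]; apply/funext => j; first by rewrite fps2_scale_in_h.
rewrite /fps2_scale big1 // => -[[|k] ki] _; rewrite big1 // => l _ /=.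
  by rewrite scaler0.
by rewrite scale0r.
Qed.

Lemma fps2_constD (a b : A) : fps2_const (a + b) = fps2_const a + fps2_const b.
Proof.
apply/funext => -[|i]; apply/funext => -[|j];
  by rewrite !addrfctE /= ?addr0.
Qed.

Lemma fps2_scale_const c (u : nat -> nat -> A) i j :
  fps2_scale (fps2_const c) u i j = c *: u i j.
Proof.
transitivity (c *: fps2_scale (fps2_monomial 0 0) u i j); last first.
  by rewrite fps2_monomial_scale !subn0.
rewrite /fps2_scale scaler_sumr; apply: eq_bigr => k _.
rewrite scaler_sumr; apply: eq_bigr => l _; rewrite scalerA; congr (_ *: _).
by case: (nat_of_ord k) (nat_of_ord l) => [|?] [|?];
  rewrite /fps2_monomial /= ?mulr1 ?mulr0.
Qed.

Lemma fps2_constZ c (a : A) :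
  fps2_const (c *: a) = fps2_scale (fps2_const c) (fps2_const a).
Proof.
apply/funext => i; apply/funext => j; rewrite fps2_scale_const.
by case: i j => [|i] [|j] //=; rewrite scaler0.
Qed.

End PowerSeriesMaps.

(** * Coefficients of a two-parameter quantization: associativity and Jacobi identities *)

Section TwoParameterQuantization.
Variables (K : fieldType) (A : lmodType K) (mu : A -> A -> A).
Variable m : (nat -> nat -> A) -> (nat -> nat -> A) -> nat -> nat -> A.
Hypotheses (q2 : quantization2 mu m) (muC : commutative mu).

(** Index [1 0] gives the first-order term along t and [0 1] the one along h. *)
Definition q2_coef i j (a b : A) : A := m (fps2_const a) (fps2_const b) i j.

Lemma q2_coef00 : q2_coef 0 0 = mu.
Proof. by apply/funext => a; apply/funext => b; apply: q2_mod. Qed.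

Lemma q2_coef_bilinear i j : bilinear_map (q2_coef i j).
Proof.
split=> [a|b] c x y; rewrite /q2_coef fps2_constD fps2_constZ.
  by rewrite (q2_addr q2) (q2_scaler q2) -fps2_scale_const.
by rewrite (q2_addl q2) (q2_scalel q2) -fps2_scale_const.
Qed.

Lemma q2_coefl u v i j : m u v i j =
  \sum_(k < i.+1) \sum_(l < j.+1) m (fps2_const (u k l)) v (i - k)%N (j - l)%N.
Proof.
by apply: (fps2_linear_coef (T := m^~ v)) => [x y|c x];
  [apply: q2_addl q2 _ _ _ | apply: q2_scalel q2 _ _ _].
Qed.

Lemma q2_coefr u v i j : m u v i j =
  \sum_(k < i.+1) \sum_(l < j.+1) m u (fps2_const (v k l)) (i - k)%N (j - l)%N.
Proof.
by apply: (fps2_linear_coef (T := m u)) => [x y|c x];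
  [apply: q2_addr q2 _ _ _ | apply: q2_scaler q2 _ _ _].
Qed.

Lemma q2_coef_assoc i j a b c :
  \sum_(k < i.+1) \sum_(l < j.+1)
    q2_coef (i - k) (j - l) a (q2_coef k l b c) =
  \sum_(k < i.+1) \sum_(l < j.+1)
    q2_coef (i - k) (j - l) (q2_coef k l a b) c.
Proof.
have /(congr1 (fun u => u i j)) :=
  q2_mulA q2 (fps2_const a) (fps2_const b) (fps2_const c).
by rewrite q2_coefr q2_coefl.
Qed.

(** Associativity at order h: the first-order term is a Hochschild 2-cocycle of [mu]. *)
Lemma q2_cocycle_h a b c :
  q2_coef 0 1 (mu a b) c + mu (q2_coef 0 1 a b) c =
  q2_coef 0 1 a (mu b c) + mu a (q2_coef 0 1 b c).
Proof.
by have := q2_coef_assoc 0 1 a b c; rewrite !big_ord_recr !big_ord0 /= !add0r q2_coef00.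
Qed.

Lemma q2_cocycle_t a b c :
  q2_coef 1 0 (mu a b) c + mu (q2_coef 1 0 a b) c =
  q2_coef 1 0 a (mu b c) + mu a (q2_coef 1 0 b c).
Proof.
by have := q2_coef_assoc 1 0 a b c; rewrite !big_ord_recr !big_ord0 /= !add0r q2_coef00.
Qed.

Let comm (u v : nat -> nat -> A) : nat -> nat -> A := m u v - m v u.

Let comm_jacobi u v w : comm (comm u v) w + comm (comm v w) u + comm (comm w u) v = 0.
Proof.
have mNl x y : m (- x) y = - m x y.
  apply: (addrI (m x y)); rewrite -(q2_addl q2) !subrr.
  by apply: (addrI (m 0 y)); rewrite -(q2_addl q2) !addr0.
have mNr x y : m x (- y) = - m x y.
  apply: (addrI (m x y)); rewrite -(q2_addr q2) !subrr.
  by apply: (addrI (m x 0)); rewrite -(q2_addr q2) !addr0.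
rewrite /comm !(q2_addl q2, q2_addr q2, mNl, mNr, q2_mulA q2); zmod.
Qed.

Let comm_coefl u c i j : comm u (fps2_const c) i j =
  \sum_(k < i.+1) \sum_(l < j.+1) skew_part (q2_coef (i - k) (j - l)) (u k l) c.
Proof.
transitivity (m u (fps2_const c) i j - m (fps2_const c) u i j); first by [].
rewrite q2_coefl [m (fps2_const c) u i j]q2_coefr -sumrB; apply: eq_bigr => k _.
by rewrite -sumrB.
Qed.

Let skew_part00 a b : skew_part (q2_coef 0 0) a b = 0.
Proof. by rewrite /skew_part q2_coef00 muC subrr. Qed.

Let comm_coef_jacobi a b c i j :
  let J x y z := \sum_(k < i.+1) \sum_(l < j.+1)
    skew_part (q2_coef (i - k) (j - l)) (skew_part (q2_coef k l) x y) z in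
  J a b c + J b c a + J c a b = 0.
Proof.
have /(congr1 (fun u => u i j)) :=
  comm_jacobi (fps2_const a) (fps2_const b) (fps2_const c).
have -> : forall v w z : nat -> nat -> A, (v + w + z) i j = v i j + w i j + z i j by [].
by rewrite !comm_coefl.
Qed.

(** In the Jacobi identity at order [h^2], the terms with [q2_coef 0 2] are paired with the skew
    part of [mu], which is zero by commutativity. *)
Lemma q2_jacobi_h a b c :
  let p := skew_part (q2_coef 0 1) in schouten p p a b c = 0.
Proof.
have := comm_coef_jacobi a b c 0 2.
have sp0 i j := bil0l (skew_part_bilinear (q2_coef_bilinear i j)).
rewrite /= !big_ord_recr !big_ord0 /= !(subSS, subn0, subnn).
rewrite !(skew_part00, sp0, add0r, addr0) => E.
(* [schouten p p] counts each term of the Jacobi identity twice, hence the two uses of [E]. *)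
by rewrite /schouten -[RHS](addr0 0) -{1}E -{1}E; zmod.
Qed.

(** Same argument at order [t h]: [q2_coef 1 1] meets only the zero skew part of [mu], leaving the
    two mixed compositions. *)
Lemma q2_jacobi_th a b c :
  schouten (skew_part (q2_coef 0 1)) (skew_part (q2_coef 1 0)) a b c = 0.
Proof.
have := comm_coef_jacobi a b c 1 1.
have sp0 i j := bil0l (skew_part_bilinear (q2_coef_bilinear i j)).
rewrite /= !big_ord_recr !big_ord0 /= !(subSS, subn0, subnn).
rewrite !(skew_part00, sp0, add0r, addr0) => E.
by rewrite /schouten -E; zmod.
Qed.

(** Setting t = 0 is multiplicative: positive powers of t in the factors cannot reach the
    coefficient of [t^0]. *)
Lemma at_t0_in_h u v j : m u v 0%N j = at_t0 m (u 0%N) (v 0%N) j.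
Proof.
rewrite /at_t0 q2_coefl [RHS]q2_coefl !big_ord1; apply: eq_bigr => l _.
by rewrite q2_coefr [RHS]q2_coefr !big_ord1.
Qed.

Lemma quantization1_at_t0 : quantization1 mu (at_t0 m).
Proof.
split=> [a a' b|a b b'|c a b|c a b|a b c|a b].
- by apply/funext => j; rewrite /at_t0 fps_in_hD (q2_addl q2).
- by apply/funext => j; rewrite /at_t0 fps_in_hD (q2_addr q2).
- by apply/funext => j; rewrite /at_t0 fps_in_hZ (q2_scalel q2) fps2_scale_in_h.
- by apply/funext => j; rewrite /at_t0 fps_in_hZ (q2_scaler q2) fps2_scale_in_h.
- have E x y : at_t0 m x y = m (fps_in_h x) (fps_in_h y) 0%N by [].
  apply/funext => j; rewrite [in LHS]E [in RHS]E.
  (* The truncated inner products are replaced by the full ones, so that associativity of [m]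
     applies. *)
  rewrite -[LHS](at_t0_in_h (fps_in_h a)) -[RHS](at_t0_in_h _ (fps_in_h c)).
  by rewrite (q2_mulA q2).
- by rewrite /at_t0 !fps_in_h_const; apply: q2_mod.
Qed.

Lemma poisson_bracket_at_t0 a b :
  poisson_bracket (at_t0 m) a b = skew_part (q2_coef 0 1) a b.
Proof. by rewrite /poisson_bracket /at_t0 !fps_in_h_const. Qed.

Lemma poisson_bracket_at_h0 a b :
  poisson_bracket (at_h0 m) a b = skew_part (q2_coef 1 0) a b.
Proof. by rewrite /poisson_bracket /at_h0 !fps_in_t_const. Qed.

End TwoParameterQuantization.

(** * The r-matrix bracket and its Schouten brackets *)

Section RMatrixBracket.
Variables (K : fieldType) (g : lieAlgType K) (r : tensor g g).
Variables (A : lmodType K) (act : envelope g -> A -> A) (mu : A -> A -> A).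
Hypotheses (skew_r : Defs.skew r) (ia : invariant_algebra act mu)
  (muC : commutative mu).

Let bmu := ia_mul_bilinear ia.
Let bact := ia_act_bilinear ia.
Let luin := (uin_lie_morphism g).1.
Local Notation rb := (r_bracket act mu r).
Local Notation "x ▷ a" := (act (uin x) a) (at level 35).

Let mu_der x a b : x ▷ mu a b = mu (x ▷ a) b + mu a (x ▷ b).
Proof.
exact: (is_invariant_uin bact (ia_act1 ia) (ia_actM ia) bmu).1 (ia_invariant ia) x a b.
Qed.

Let act_lie x y a : lie x y ▷ a = x ▷ (y ▷ a) - y ▷ (x ▷ a).
Proof.
by rewrite (uin_lie_morphism g).2 (bilDl bact) (bilNl bact) !(ia_actM ia).
Qed.

Let muA := ia_mulA ia.

Lemma mul_act_r (f : A -> A -> A) a b : bilinear_map f ->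
  mul_act act f (tlift (fun x y => uin x ⊗ uin y) r) a b =
  tlift (fun x y => f (x ▷ a) (y ▷ b)) r.
Proof.
move=> bf; rewrite (linear_tlift _ _ (mul_act_linear bact a b bf)).
by apply: eq_tlift => x y; rewrite (mul_act_pure bact).
Qed.

Lemma r_bracket_bilinear : bilinear_map rb.
Proof.
split=> [a|b] c x y; apply: tlift_comb => u v.
  by rewrite bact.1 bmu.1.
by rewrite bact.1 bmu.2.
Qed.

(** Skew-symmetry combines that of [r] with commutativity of [mu]; the Leibniz rule holds because g
    acts by derivations. *)
Lemma r_bracket_bracket : is_bracket mu rb.
Proof.
have sk a b : rb a b = - rb b a.
  rewrite /r_bracket -(tlift_skew skew_r).
    by apply: eq_tlift => x y; rewrite muC.
  by split=> [x|y] c u v; rewrite luin bact.2 (bmu.1, bmu.2).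
have L a b c : rb (mu a b) c = mu a (rb b c) + mu (rb a c) b.
  rewrite (linear_tlift _ _ (bmu.1 a)) (linear_tlift _ _ (bmu.2 b)) -tliftD.
  apply: eq_tlift => x y; rewrite mu_der (bilDl bmu) addrC -!muA.
  by congr (_ + mu _ _); rewrite muC.
split=> //; first exact: r_bracket_bilinear.
move=> a b c; rewrite sk L opprD -(bilNr bmu) -(bilNl bmu) -!sk.
by rewrite addrC.
Qed.

(** The Leibniz rule and the invariance of [f] turn every term into a [G] or an [H], and
    skew-symmetry of [r] turns [H] into [G]. In the cyclic sum each permutation of the arguments of
    [G] then occurs once with each sign. *)
Lemma schouten_invariant_r_bracket (f : A -> A -> A) a b c :
  is_bracket mu f -> is_invariant act f -> schouten f rb a b c = 0.
Proof.
move=> bf /(is_invariant_uin bact (ia_act1 ia) (ia_actM ia) (br_bilinear bf)) inv.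
have bbf := br_bilinear bf.
pose G a b c := tlift (fun x y => mu (x ▷ a) (f (y ▷ b) c)) r.
pose H a b c := tlift (fun x y => mu (f (x ▷ a) b) (y ▷ c)) r.
have HG a' b' c' : H a' b' c' = - G c' a' b'.
  rewrite /G -(tlift_skew skew_r).
    by apply: eq_tlift => x y; rewrite muC.
  by split=> [x|y] k u v; rewrite luin bact.2 ?bbf.2 (bmu.1, bmu.2).
have E1 a' b' c' : f (rb a' b') c' = G a' b' c' + H a' c' b'.
  rewrite (linear_tlift _ _ (bbf.2 c')) -tliftD; apply: eq_tlift => x y.
  by rewrite (br_leibnizl bf).
have E2 a' b' c' : rb (f a' b') c' = H a' b' c' - H b' a' c'.
  rewrite -tliftN -tliftD; apply: eq_tlift => x y.
  by rewrite inv (bilDl bmu) -(bilNl bmu) -(br_skew bf).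
by rewrite /schouten !E1 !E2 !HG; zmod.
Qed.

(** Sums over two copies [x ⊗ y] and [x' ⊗ y'] of [r]: exchanging the copies changes nothing,
    transposing one of them changes the sign. *)
Let dbl (b : g -> g -> g -> g -> A) : A :=
  tlift (fun x y => tlift (b x y) r) r.

Let dblX b : dbl (fun x y x' y' => b x' y' x y) = dbl b.
Proof. by rewrite /dbl tlift_exchange. Qed.

Let dblS b : (forall x y, bilinear_map (b x y)) ->
  dbl (fun x y x' y' => b x y y' x') = - dbl b.
Proof.
move=> bb; rewrite /dbl -tliftN; apply: eq_tlift => x y.
exact: tlift_skew.
Qed.

Let dblS' b : (forall x' y', bilinear_map (fun x y => b x y x' y')) ->
  dbl (fun x y x' y' => b y x x' y') = - dbl b.
Proof.
by move=> bb; rewrite -dblX -[in RHS]dblX -dblS // => x' y'; apply: bb.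
Qed.

Let eq_dbl b b' : (forall x y x' y', b x y x' y' = b' x y x' y') -> dbl b = dbl b'.
Proof. by move=> E; do 2!apply: eq_tlift => ? ?; apply: E. Qed.

Let dblD b b' : dbl (fun x y x' y' => b x y x' y' + b' x y x' y') = dbl b + dbl b'.
Proof. by rewrite /dbl -tliftD; apply: eq_tlift => x y; rewrite -tliftD. Qed.

Let dblN b : dbl (fun x y x' y' => - b x y x' y') = - dbl b.
Proof. by rewrite /dbl -tliftN; apply: eq_tlift => x y; rewrite -tliftN. Qed.

Lemma trivector_linear a b c : linear (fun phi => trivector act mu phi a b c).
Proof.
apply: tlift_linear; split=> [x|q] k u v.
  by apply: tlift_linear; split=> [y|z] k' u' v'; rewrite luin bact.2 ?(bmu.1, bmu.2).
by apply: tlift_comb => y z; rewrite luin bact.2 !bmu.2.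
Qed.

Lemma trivector_pure x y z a b c :
  trivector act mu (x ⊗ (y ⊗ z)) a b c =
  mu (mu (x ▷ a) (y ▷ b)) (z ▷ c).
Proof.
have B x' : bilinear_map (fun y z => mu (mu (x' ▷ a) (y ▷ b)) (z ▷ c)).
  by split=> [y'|z'] k u v; rewrite luin bact.2 ?(bmu.1, bmu.2).
rewrite /trivector tliftE ?tliftE //.
split=> [x'|q] k u v; first exact: tlift_linear.
by apply: tlift_comb => y' z'; rewrite luin bact.2 !bmu.2.
Qed.

Local Ltac bilin :=
  let k := fresh in let u := fresh in let v := fresh in
  split=> ? k u v; rewrite luin bact.2 ?bact.1 ?(bmu.1, bmu.2) ?(bmu.1, bmu.2).

(** Both sides are expanded into the six double sums [U1], ..., [V3]; each equals
    [-2 (U1 - V1 + U2 - V2 + U3 - V3)]. *)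
Lemma schouten_r_bracket a b c :
  schouten rb rb a b c = trivector act mu (schouten_wedge2 r r) a b c.
Proof.
have lT := trivector_linear a b c.
have TD p q : trivector act mu (p + q) a b c =
    trivector act mu p a b c + trivector act mu q a b c.
  by have := lT 1 p q; rewrite !scale1r.
have TN p : trivector act mu (- p) a b c = - trivector act mu p a b c.
  by have := lT (-1) p 0; rewrite (linear_map0 lT) !addr0 !scaleN1r.
(* The index tells which of [a], [b], [c] is acted on by both copies of [r]; [U] and [V] differ in
   the order of these two actions and form a commutator. *)
pose U1 := dbl (fun x y x' y' => mu (mu (x ▷ (x' ▷ a)) (y ▷ b)) (y' ▷ c)).
pose V1 := dbl (fun x y x' y' => mu (mu (x' ▷ (x ▷ a)) (y ▷ b)) (y' ▷ c)).
pose U2 := dbl (fun x y x' y' => mu (mu (x ▷ a) (y ▷ (x' ▷ b))) (y' ▷ c)).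
pose V2 := dbl (fun x y x' y' => mu (mu (x ▷ a) (x' ▷ (y ▷ b))) (y' ▷ c)).
pose U3 := dbl (fun x y x' y' => mu (mu (x ▷ a) (x' ▷ b)) (y ▷ (y' ▷ c))).
pose V3 := dbl (fun x y x' y' => mu (mu (x ▷ a) (x' ▷ b)) (y' ▷ (y ▷ c))).
have EYB : trivector act mu (yang_baxter r r) a b c =
    U1 - V1 + (U2 - V2) + (U3 - V3).
  rewrite /yang_baxter (linear_tlift _ _ lT).
  rewrite -!dblN -!dblD; apply: eq_tlift => x y; rewrite (linear_tlift _ _ lT).
  apply: eq_tlift => x' y'; rewrite !TD !trivector_pure !act_lie.
  by rewrite !(bilDl bmu, bilNl bmu, bilDr bmu, bilNr bmu).
have RR a' b' c' : rb (rb a' b') c' =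
    dbl (fun x y x' y' => mu (mu (x' ▷ (x ▷ a')) (y ▷ b')) (y' ▷ c')) +
    dbl (fun x y x' y' => mu (mu (x ▷ a') (x' ▷ (y ▷ b'))) (y' ▷ c')).
  rewrite -dblD -dblX; apply: eq_tlift => x' y'.
  rewrite (linear_tlift _ _ (bact.1 _)) (linear_tlift _ _ (bmu.2 _)).
  by apply: eq_tlift => x y; rewrite mu_der (bilDl bmu).
(* For the arguments [a b c], [RR] gives [V1 + V2] directly. The cyclically rotated terms are
   brought back to the list by exchanging or transposing copies of [r]; [S3] takes two
   transpositions, hence its plus sign. *)
have S1 : dbl (fun x y x' y' => mu (mu (x' ▷ (x ▷ b)) (y ▷ c)) (y' ▷ a)) = - U2.
  rewrite /U2 -[in RHS]dblX -dblS => [|x y]; last first.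
    by bilin.
  by apply: eq_dbl => x y x' y'; rewrite (muC _ (y' ▷ a)) !muA.
have S2 : dbl (fun x y x' y' => mu (mu (x ▷ b) (x' ▷ (y ▷ c))) (y' ▷ a)) = - U3.
  rewrite /U3 -[in RHS]dblX -dblS => [|x y]; last first.
    by bilin.
  by apply: eq_dbl => x y x' y'; rewrite (muC _ (y' ▷ a)) !muA.
have S3 : dbl (fun x y x' y' => mu (mu (x' ▷ (x ▷ c)) (y ▷ a)) (y' ▷ b)) = V3.
  rewrite -[RHS]opprK /V3 -dblS' => [|x' y']; last first.
    by bilin.
  rewrite -dblS => [|x y]; last first.
    by bilin.
  by apply: eq_dbl => x y x' y'; rewrite -muA muC.
have S4 : dbl (fun x y x' y' => mu (mu (x ▷ c) (x' ▷ (y ▷ a))) (y' ▷ b)) = - U1.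
  rewrite /U1 -[in RHS]dblX -dblS' => [|x' y']; last first.
    by bilin.
  by apply: eq_dbl => x y x' y'; rewrite -muA muC.
by rewrite /schouten !RR S1 S2 S3 S4 /schouten_wedge2 TN TD EYB -/V1 -/V2; zmod.
Qed.

End RMatrixBracket.

(** * First-order consequences of invariance under the quantum group *)

Section QuantumGroupInvariance.
Variables (K : fieldType) (g : lieAlgType K) (r : tensor g g).
Variables (Q : quantum_group r) (A : lmodType K).
Variables (act : envelope g -> A -> A) (mu : A -> A -> A).
Variable m : (nat -> nat -> A) -> (nat -> nat -> A) -> nat -> nat -> A.
Hypotheses (ia : invariant_algebra act mu) (q2 : quantization2 mu m).

Let bmu := ia_mul_bilinear ia.
Let bact := ia_act_bilinear ia.
Let act0 x : act x 0 = 0 := bil0r bact x.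

(** At order h, the inverse of [1 + h F_1 + ...] is [1 - h F_1 + ...], so conjugation by it gives a
    commutator. *)
Lemma qg_comult1E x :
  qg_comult Q x 1%N = qg_F Q 1%N * comult x - comult x * qg_F Q 1%N.
Proof.
have Fi0 : qg_Finv Q 0%N = 1.
  have := congr1 (fun u => u 0%N) (qg_FK Q).
  by rewrite /fps_mul big_ord1 /= qg_F0 mul1r.
have Fi1 : qg_Finv Q 1%N = - qg_F Q 1%N.
  have := congr1 (fun u => u 1%N) (qg_FK Q).
  rewrite /fps_mul !big_ord_recr big_ord0 /= qg_F0 Fi0 mul1r mulr1 add0r.
  by move/eqP; rewrite addr_eq0 => /eqP.
rewrite /qg_comult /fps_mul !big_ord_recr !big_ord0 /= !add0r qg_F0 Fi0 Fi1.
by rewrite mul1r mulr0 add0r mulr1 mulrN addrC.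
Qed.

Lemma mul_act_coef T a b i j :
  mul_act (fps2_act act) m T (fps2_const a) (fps2_const b) i j =
  mul_act act (q2_coef m i j) T a b.
Proof.
rewrite /mul_act (linear_tlift (L := fun z : nat -> nat -> A => z i j)) //.
have E u c : fps2_act act u (fps2_const c) = fps2_const (act u c).
  by apply/funext => -[|k]; apply/funext => -[|l]; rewrite /fps2_act //= act0.
by apply: eq_tlift => u v; rewrite !E.
Qed.

Lemma fps2_act_in_h x a : fps2_act act x (fps_in_h a) = fps_in_h (fps_act act x a).
Proof. by apply/funext => -[|i]; apply/funext => j; rewrite /fps2_act //= act0. Qed.

Lemma fps_act_const x (a : A) :
  fps_act act x (fps_const a) = fps_const (act x a).
Proof. by apply/funext => -[|i]; rewrite /fps_act //= act0. Qed.

(** Compares coefficients of [t^0] on series in h alone; reading a coefficient is linear and passes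
    through the lift. *)
Lemma Uh_invariant1_at_t0 :
  Uh_invariant2 Q act m -> Uh_invariant1 Q act (at_t0 m).
Proof.
move=> inv x a b; apply/funext => j.
have := congr1 (fun u => u 0%N j) (inv x (fps_in_h a) (fps_in_h b)).
move=> E; apply: (etrans E); apply: eq_bigr => k _.
rewrite /mul_act (linear_tlift (L := fun z : nat -> nat -> A => z 0%N (j - k)%N)) //.
rewrite (linear_tlift (L := fun z : nat -> A => z (j - k)%N)) //.
by apply: eq_tlift => u v; rewrite !fps2_act_in_h.
Qed.

Lemma q2_coef_invariant_h : (2 : K) != 0 -> Uh_invariant2 Q act m ->
  is_invariant act (fun a b => 2 *: q2_coef m 0 1 a b + r_bracket act mu r a b).
Proof.
move=> nz2 inv x a b.
have bM := q2_coef_bilinear q2 0 1; have brb := r_bracket_bilinear r ia.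
have := congr1 (fun u => u 0%N 1%N) (inv x (fps2_const a) (fps2_const b)).
rewrite /fps2_sum !big_ord_recr big_ord0 /= add0r !mul_act_coef (q2_coef00 q2).
rewrite qg_comult0 qg_comult1E qg_F1 => E.
have {}E : act x (q2_coef m 0 1 a b) = mul_act act (q2_coef m 0 1) (comult x) a b +
    2^-1 *: (mul_act act (r_bracket act mu r) (comult x) a b -
             act x (r_bracket act mu r a b)).
  rewrite [LHS]E; congr (_ + _); have lmu := mul_act_linear bact a b bmu.
  have lmuZ c T : mul_act act mu (c *: T) a b = c *: mul_act act mu T a b.
    by have := lmu c T 0; rewrite (linear_map0 lmu) !addr0.
  have lmuB S T : mul_act act mu (S - T) a b =
      mul_act act mu S a b - mul_act act mu T a b.
    by rewrite [S - T]addrC -[- T]scaleN1r lmu scaleN1r addrC.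
  rewrite -scalerAl -scalerAr -scalerBr lmuZ lmuB; congr (_ *: (_ - _)).
    (* Composing [mu] with [r] gives the r-matrix bracket, to which [comult x] is then applied. *)
    rewrite (mul_actM bact (ia_actM ia)) //; apply: eq_tlift => u v.
    by rewrite (mul_act_r r ia).
  (* In the opposite order [comult x] meets [mu] first, and invariance of [mu] moves [x] outside. *)
  rewrite (mul_actM bact (ia_actM ia)) // (mul_act_r r ia); last first.
    exact: mul_act_bilinear.
  rewrite (linear_tlift _ _ (bact.1 x)); apply: eq_tlift => y z.
  by rewrite (ia_invariant ia).
rewrite (bilDr bact) (bilZr bact) E scalerDr scalerA divff // scale1r.
have -> : mul_act act (fun a b => 2 *: q2_coef m 0 1 a b + r_bracket act mu r a b)
    (comult x) a b =
    2 *: mul_act act (q2_coef m 0 1) (comult x) a b +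
    mul_act act (r_bracket act mu r) (comult x) a b.
  exact: tlift_comb.
by rewrite -addrA subrK.
Qed.

End QuantumGroupInvariance.

(** * Sums of brackets, additivity of the Schouten bracket, and the final assembly *)

Section Brackets.
Variables (K : fieldType) (A : lmodType K) (mu : A -> A -> A).
Hypothesis bmu : bilinear_map mu.
Implicit Types f p s : A -> A -> A.

Lemma is_bracketD f p : is_bracket mu f -> is_bracket mu p ->
  is_bracket mu (fun a b => f a b + p a b).
Proof.
move=> bf bp; split.
- by apply: bilinear_mapD; [exact: br_bilinear bf | exact: br_bilinear bp].
- by move=> a b; rewrite (br_skew bf) (br_skew bp) opprD.
- move=> a b c; rewrite (br_leibnizl bf) (br_leibnizl bp).
  by rewrite (bilDl bmu) (bilDr bmu) addrACA.
- move=> a b c; rewrite (br_leibnizr bf) (br_leibnizr bp).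
  by rewrite (bilDl bmu) (bilDr bmu) addrACA.
Qed.

Lemma schoutenC f p a b c : schouten f p a b c = schouten p f a b c.
Proof. by rewrite /schouten; zmod. Qed.

Lemma schoutenDl f p s a b c : bilinear_map s ->
  schouten (fun x y => f x y + p x y) s a b c =
  schouten f s a b c + schouten p s a b c.
Proof. by move=> bs; rewrite /schouten !(bilDl bs); zmod. Qed.

End Brackets.

Theorem corollary2p1 (R : realType) (g : lieAlgType R[i]) (r : tensor g g)
    (Q : quantum_group r) (A : lmodType R[i]) (act : envelope g -> A -> A)
    (mu : A -> A -> A)
    (m : (nat -> nat -> A) -> (nat -> nat -> A) -> (nat -> nat -> A))
    (s : A -> A -> A) :
  semisimple g ->
  classical_r_matrix r ->
  invariant_algebra act mu ->
  commutative mu ->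
  quantization2 mu m ->
  Uh_invariant2 Q act m ->
  quantization1 mu (at_h0 m) ->
  U_invariant1 act (at_h0 m) ->
  (forall a b, s a b = poisson_bracket (at_h0 m) a b) ->
  quantization1 mu (at_t0 m) /\
  Uh_invariant1 Q act (at_t0 m) /\
  exists f : A -> A -> A,
    is_bracket mu f /\
    is_invariant act f /\
    (forall a b,
       poisson_bracket (at_t0 m) a b = (f a b - r_bracket act mu r a b)%R) /\
    (forall a b c,
       schouten f f a b c = (- trivector act mu (schouten_wedge2 r r) a b c)%R) /\
    (forall a b c, schouten f s a b c = 0%R).
Proof.
move=> _ [skew_r _] ia muC q2 invh _ invt sE.
set c01 := q2_coef m 0 1; set c10 := q2_coef m 1 0; set rb := r_bracket act mu r.
have bact := ia_act_bilinear ia; have bmu := ia_mul_bilinear ia.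
have b01 : bilinear_map c01 := q2_coef_bilinear q2 0 1.
have b10 : bilinear_map c10 := q2_coef_bilinear q2 1 0.
have uinP := is_invariant_uin bact (ia_act1 ia) (ia_actM ia).
have brb : is_bracket mu rb := r_bracket_bracket skew_r ia muC.
have brp : is_bracket mu (skew_part c01).
  exact: skew_part_bracket muC bmu b01 (q2_cocycle_h q2).
have {sE} -> : s = skew_part c10.
  by do 2!apply/funext => ?; rewrite sE poisson_bracket_at_h0.
have brs : is_bracket mu (skew_part c10).
  exact: skew_part_bracket muC bmu b10 (q2_cocycle_t q2).
have nz2 : (2 : R[i]) != 0 by rewrite Num.Theory.pnatr_eq0.
pose f a b := skew_part c01 a b + rb a b.
have brf : is_bracket mu f by apply: is_bracketD.
have invf : is_invariant act f.
  apply/uinP => [|x a b]; first exact: br_bilinear brf.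
  have := q2_coef_invariant_h ia q2 nz2 invh.
  have bM : bilinear_map (fun a b => 2 *: c01 a b + rb a b).
    by apply: bilinear_mapD (br_bilinear brb); apply: bilinear_mapZ.
  move=> /(is_invariant_skew_part bact (ia_act1 ia) (ia_actM ia) bM).
  (* As [rb] is skew-symmetric, its own skew part is [2 rb]; the common factor 2 is then divided
     out. *)
  have -> : skew_part (fun a b => 2 *: c01 a b + rb a b) = fun a b => 2 *: f a b.
    apply/funext => a'; apply/funext => b'.
    rewrite /skew_part (br_skew brb b' a') /f /skew_part !scaler_nat !mulr2n; zmod.
  move/uinP => /(_ (bilinear_mapZ (br_bilinear brf) 2) x a b).
  rewrite (bilZr bact) -scalerDr => /(congr1 (fun u => 2^-1 *: u)).
  by rewrite !scalerA mulVf // !scale1r.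
(* The coefficient of t in the U(g)-invariance of [at_h0 m] makes [c10] invariant, hence its skew
   part. *)
have invs : is_invariant act (skew_part c10).
  apply: (is_invariant_skew_part bact (ia_act1 ia) (ia_actM ia) b10) => x a b.
  have := congr1 (fun u => u 1%N) (invt x (fps_const a) (fps_const b)).
  rewrite /mul_act (linear_tlift (L := fun z : nat -> A => z 1%N)) //.
  rewrite {1}/fps_act /at_h0 !fps_in_t_const => -> //.
  apply: eq_tlift => u v.
  by rewrite !(fps_act_const ia) !fps_in_t_const.
split; first exact: quantization1_at_t0.
split; first exact: (Uh_invariant1_at_t0 ia).
exists f; split=> //; split=> //; split=> [a b|].
  by rewrite poisson_bracket_at_t0 addrK.
have frb a b c : schouten f rb a b c = 0.
  by apply: (schouten_invariant_r_bracket skew_r ia muC).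
have srb a b c : schouten (skew_part c10) rb a b c = 0.
  by apply: (schouten_invariant_r_bracket skew_r ia muC).
split=> a b c.
  rewrite -(schouten_r_bracket skew_r ia muC) -/rb.
  (* With p = [skew_part c01]: [[f,f]] = [[p,f]] = [[p,p]] + [[rb,p]] = [[rb,p]] = -[[rb,rb]], where
     the first and last equalities use [[f,rb]] = 0. *)
  have := schoutenDl (skew_part c01) rb a b c (br_bilinear brf).
  rewrite -/(f) (schoutenC rb f) frb addr0 => ->.
  rewrite schoutenC [LHS]schoutenDl; last exact: br_bilinear brp.
  rewrite (q2_jacobi_h q2 muC) add0r.
  apply/eqP; rewrite -addr_eq0 -schoutenC -(schoutenDl _ rb _ _ _ (br_bilinear brb)).
  by rewrite -/f frb.
(* Here [[f,s]] = [[p,s]] + [[rb,s]]: the first term vanishes by Jacobi at order [t h], the second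
   by invariance of s. *)
rewrite [LHS]schoutenDl; last exact: br_bilinear brs.
by rewrite (q2_jacobi_th q2 muC) schoutenC srb addr0.
Qed.
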